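(* Let $V,Y$ be real Banach spaces, $U\subset V$ open, $m\in\mathbb{N}$, $\mathcal{E}\colon U\to\mathbb{R}$, $\mathcal{G}\colon U\to\mathbb{R}^m$ analytic, $\bar u\in U$, and assume: (i) $V\hookrightarrow Y$ continuously and densely; (ii) $\mathcal{E}'(u)\in Y^\ast$ for all $u\in U$ and $u\mapsto\mathcal{E}'(u)$ is analytic $U\to Y^\ast$; (iii) $\mathcal{E}''(\bar u)\colon V\to Y^\ast$ is Fredholm of index zero; (iv) each $\mathcal{G}'(u)$ extends to $\overline{\mathcal{G}'(u)}\in\mathcal{L}(Y,\mathbb{R}^m)$ and $u\mapsto\overline{\mathcal{G}'(u)}$ is analytic $U\to\mathcal{L}(Y,\mathbb{R}^m)$; (v) $(\overline{\mathcal{G}'})'(\bar u)\colon V\to\mathcal{L}(Y,\mathbb{R}^m)$ is compact; (vi) $\mathcal{G}(\bar u)=0$ and $\mathcal{G}'(\bar u)$ is surjective. Let $V_0=\ker\mathcal{G}'(\bar u)$, $V_1$ a closed complement, $\Omega_0\subset V_0$, $\Omega_1\subset V_1$ open with $\bar u\in\Omega=\Omega_0+\Omega_1\subset U$, $\psi\colon\Omega_0\to V$ analytic with $\psi(\Omega_0)\subset\Omega_1$, $\{u\in\Omega\mid\mathcal{G}(u)=0\}=\{\omega+\psi(\omega)\mid\omega\in\Omega_0\}$, and $\mathcal{G}'(u)|_{V_1}$ an isomorphism onto $\mathbb{R}^m$ for $u\in\Omega$. Let $\varphi(\omega)=\omega+\psi(\omega)$, $\mathcal{F}=\mathcal{E}\circ\varphi$,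 and regard $\omega\mapsto\mathcal{F}'(\omega)$ as an (analytic) map $\Omega_0\to\overline{V_0}^\ast$, where $\overline{V_0}$ is the $Y$-closure of $V_0$ and $\mathcal{F}'(\omega)$ is identified with its continuous extension to $\overline{V_0}$. Then for $\bar\omega\in\Omega_0$ with $\varphi(\bar\omega)=\bar u$, the derivative $\mathcal{F}''(\bar\omega)\colon V_0\to\overline{V_0}^\ast$ is a Fredholm operator of index zero.
   Context: Analytic means locally given by norm-convergent power series of continuous multilinear maps. $\overline{V_0}^\ast$ is the dual of $\overline{V_0}$ with the $Y$-norm; $\mathcal{E}''(\bar u)$ is the Fréchet derivative at $\bar u$ of $u\mapsto\mathcal{E}'(u)\in Y^\ast$. *)

(* Defs.v *)
From HB Require Import structures.
From mathcomp Require Import all_boot all_order all_algebra.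
From mathcomp Require Import all_classical all_reals all_analysis.
Set Implicit Arguments. Unset Strict Implicit. Unset Printing Implicit Defensive.
Import Order.TTheory GRing.Theory Num.Theory.
Import numFieldNormedType.Exports.
Local Open Scope classical_set_scope.
Local Open Scope ring_scope.

Section Defs.
Variable R : realType.

Definition lin_subspace (P : normedModType R) (S : set P) : Prop :=
  S 0 /\ forall (a : R) x y, S x -> S y -> S (a *: x + y).

Definition open_in (P : normedModType R) (S O : set P) : Prop :=
  forall w, O w -> S w /\
    exists2 r : R, 0 < r & forall h, S h -> `|h - w| < r -> O h.

Definition minkowski_sum (P : normedModType R) (A B : set P) : set P :=
  [set u | exists a b, A a /\ B b /\ u = a + b].

(* f : X -> Z is linear and bounded on the subspace D (an element of D^* / L(D,Z)
   with the norm of X) *)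
Definition bounded_lin (X Z : normedModType R) (D : set X) (f : X -> Z) : Prop :=
  (forall (a : R) x y, D x -> D y -> f (a *: x + y) = a *: f x + f y) /\
  exists c : R, forall x, D x -> `|f x| <= c * `|x|.

Definition is_fderiv (P Z : normedModType R) (S : set P) (f : P -> Z) (p : P)
  (L : P -> Z) : Prop :=
  bounded_lin S L /\
  forall eps : R, 0 < eps -> exists2 delta : R, 0 < delta &
    forall h, S h -> `|h| < delta -> `|f (p + h) - f p - L h| <= eps * `|h|.

(* T : S -> L(D, Z) is a bounded linear operator, the space L(D,Z) carrying
   the operator norm sup_{x in D, |x| <= 1} *)
Definition op_bounded_lin (P X Z : normedModType R) (S : set P) (D : set X)
  (T : P -> X -> Z) : Prop :=
  (forall (a : R) u v x, S u -> S v -> D x -> T (a *: u + v) x = a *: T u x + T v x) /\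
  (forall h, S h -> bounded_lin D (T h)) /\
  exists c : R, forall h x, S h -> D x -> `|T h x| <= c * `|h| * `|x|.

Definition is_op_deriv (P X Z : normedModType R) (S : set P) (D : set X)
  (Phi : P -> X -> Z) (p : P) (T : P -> X -> Z) : Prop :=
  op_bounded_lin S D T /\
  forall eps : R, 0 < eps -> exists2 delta : R, 0 < delta &
    forall h x, S h -> `|h| < delta -> D x ->
      `|Phi (p + h) x - Phi p x - T h x| <= eps * `|h| * `|x|.

Definition upd (P : Type) (k : nat) (hs : 'I_k -> P) (i : 'I_k) (w : P) : 'I_k -> P :=
  fun j => if j == i then w else hs j.

Definition multilin (P Z : normedModType R) (S : set P) (k : nat)
  (A : ('I_k -> P) -> Z) (c : R) : Prop :=
  (forall (hs : 'I_k -> P) i (a : R) u v, (forall j, S (hs j)) -> S u -> S v ->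
     A (upd hs i (a *: u + v)) = a *: A (upd hs i u) + A (upd hs i v)) /\
  forall hs : 'I_k -> P, (forall j, S (hs j)) ->
     `|A hs| <= c * \prod_(j < k) `|hs j|.

Definition analytic_on (P Z : normedModType R) (S O : set P) (f : P -> Z) : Prop :=
  open_in S O /\
  forall p0, O p0 -> exists2 r : R, 0 < r &
    exists (A : forall k : nat, ('I_k -> P) -> Z) (c : nat -> R),
      (forall k, 0 <= c k /\ multilin S (A k) (c k)) /\
      (exists M : R, forall N, \sum_(k < N) c k * r ^+ k <= M) /\
      forall h, S h -> `|h| < r -> O (p0 + h) /\
        (fun N => \sum_(k < N) A k (fun=> h)) @ \oo --> f (p0 + h).

Definition multilin_op (P X Z : normedModType R) (S : set P) (D : set X) (k : nat)
  (A : ('I_k -> P) -> X -> Z) (c : R) : Prop :=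
  (forall (hs : 'I_k -> P) i (a : R) u v x, (forall j, S (hs j)) -> S u -> S v -> D x ->
     A (upd hs i (a *: u + v)) x = a *: A (upd hs i u) x + A (upd hs i v) x) /\
  (forall hs : 'I_k -> P, (forall j, S (hs j)) -> bounded_lin D (A hs)) /\
  forall (hs : 'I_k -> P) x, (forall j, S (hs j)) -> D x ->
     `|A hs x| <= c * \prod_(j < k) `|hs j| * `|x|.

(* Phi : O -> L(D,Z) is analytic for the operator norm.  Pointwise convergence
   together with the norm bounds is equivalent to operator-norm convergence. *)
Definition analytic_op_on (P X Z : normedModType R) (S O : set P) (D : set X)
  (Phi : P -> X -> Z) : Prop :=
  open_in S O /\
  (forall p, O p -> bounded_lin D (Phi p)) /\
  forall p0, O p0 -> exists2 r : R, 0 < r &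
    exists (A : forall k : nat, ('I_k -> P) -> X -> Z) (c : nat -> R),
      (forall k, 0 <= c k /\ multilin_op S D (A k) (c k)) /\
      (exists M : R, forall N, \sum_(k < N) c k * r ^+ k <= M) /\
      forall h, S h -> `|h| < r -> O (p0 + h) /\
        forall x, D x ->
          (fun N => \sum_(k < N) A k (fun=> h) x) @ \oo --> Phi (p0 + h) x.

Definition dim_eq (P : normedModType R) (K : set P) (n : nat) : Prop :=
  exists b : 'I_n -> P, (forall i, K (b i)) /\
    (forall c : 'I_n -> R, \sum_(i < n) c i *: b i = 0 -> forall i, c i = 0) /\
    (forall h, K h -> exists c : 'I_n -> R, h = \sum_(i < n) c i *: b i).

Definition fredholm0 (P X : normedModType R) (S : set P) (D : set X)
  (T : P -> X -> R) : Prop :=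
  op_bounded_lin S D T /\
  (* closed range *)
  (forall f, bounded_lin D f ->
     (forall eps : R, 0 < eps -> exists h, S h /\
        forall x, D x -> `|f x - T h x| <= eps * `|x|) ->
     exists h, S h /\ forall x, D x -> f x = T h x) /\
  exists n : nat,
    dim_eq [set h | S h /\ forall x, D x -> T h x = 0] n /\
    (* codim range T = n *)
    exists g : 'I_n -> X -> R, (forall i, bounded_lin D (g i)) /\
      (forall f, bounded_lin D f -> exists h (c : 'I_n -> R), S h /\
         forall x, D x -> f x = T h x + \sum_(i < n) c i * g i x) /\
      (forall h (c : 'I_n -> R), S h ->
         (forall x, D x -> T h x + \sum_(i < n) c i * g i x = 0) ->
         forall i, c i = 0).

(* compact operator  K : V -> L(Y,Z): the image of the unit ball is relatively
   compact for the operator norm *)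
Definition compact_op (P X Z : normedModType R) (K : P -> X -> Z) : Prop :=
  forall v : nat -> P, (forall n, `|v n| <= 1) ->
    exists (sigma : nat -> nat) (L : X -> Z),
      (forall n, (sigma n < sigma n.+1)%N) /\ bounded_lin setT L /\
      forall eps : R, 0 < eps -> exists N : nat, forall n, (N <= n)%N ->
        forall x, `|K (v (sigma n)) x - L x| <= eps * `|x|.

End Defs.

(* Main.v *)
Require Import Defs.
From HB Require Import structures.
From mathcomp Require Import all_boot all_order all_algebra.
From mathcomp Require Import all_classical all_reals all_analysis.
From mathcomp Require Import perm ring lra.
Import Order.TTheory GRing.Theory Num.Theory.
Import numFieldNormedType.Exports.
Local Open Scope classical_set_scope.
Local Open Scope ring_scope.

(* With lam the Lagrange multiplier lam z = - E'(ubar) (B z), where B inverts G'(ubar) on V1,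
   F''(wbar) is the restriction of E''(ubar) + lam (G'')(ubar) to V0 x V0bar, because
   psi'(wbar) = 0; it is E'' plus a compact operator, restricted in domain and target to
   subspaces of the same codimension m.

   Index zero is handled without complements of kernels: T : P -> X^* is Fredholm of index
   zero iff, for suitable functionals g_1, ..., g_N, the operator
   (p, d) |-> T p + \sum_j d_j g_j  is onto and has an N-dimensional kernel.
   To add a compact K, take for the g_j also a finite net of the image under K of the
   unit ball: modulo the span of the g_j the operators T + t K, 0 <= t <= 1, are small
   perturbations of T, so by Neumann iteration they are onto with a uniform constant.
   The kernels for t and t' are then O(|t - t'|)-close to each other, and subspaces which
   are close in terms of their dimension only have equal dimensions. *)

Set Implicit Arguments.
Unset Strict Implicit.
Unset Printing Implicit Defensive.

(** A functional on [D] is a function on all of [X] that is linear and bounded on [D], and an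
    operator into the dual is a function of two arguments. Solvability is therefore quantitative:
    for a functional of bound c there is a preimage of norm at most C c.

    Index zero comes from a dimension count. With n functionals for the cokernel and k for the net,
    the augmented operator is onto with kernel of dimension n + k. Testing only on the closure of
    V0, of codimension m, raises this to n + k + m. The domain V0 is then cut out by as many scalar
    constraints: n + k vanishing coefficients and the m components of G'(ubar). On the kernel these
    constraints form a square matrix, whose kernel and cokernel have equal dimension.

    For F'', the obstacle is that the inverse B_v of G' on V1 varies with the base point v. It is
    applied to G'(ubar + k) x, which is already O(|k||x|) for x in the closure of V0, so its
    variation enters only at second order. *)

(** * Geometric series and completeness *)

Lemma rV_norm_le (R : realType) n (v : 'rV[R]_n) (c : R) :
  0 <= c -> (forall j, `|v 0 j| <= c) -> `|v| <= c.
Proof.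
move=> c0 vc; rewrite /Num.Def.normr/= mx_normrE; apply: bigmax_le => // -[i j] _ /=.
by rewrite ord1.
Qed.

Lemma rV_norm_ge (R : realType) n (v : 'rV[R]_n) j : `|v 0 j| <= `|v|.
Proof.
rewrite [leRHS]/Num.Def.normr/= mx_normrE.
exact: (le_bigmax _ (fun ij : 'I_1 * 'I_n => `|v ij.1 ij.2|) (0, j)).
Qed.

(** Completeness in the form that Neumann iteration consumes. It passes coordinatewise to the
    augmented domains [P * 'rV_k], and the tail bound gives both the size of the limit (k = 0) and
    the rate of convergence. *)
Definition geom_complete (R : realType) (P : normedModType R) :=
  forall (u : nat -> P) (M q : R), 0 < q < 1 ->
    (forall k, `|u k| <= M * q ^+ k) ->
    exists l, forall k, `|l - \sum_(i < k) u i| <= M * q ^+ k / (1 - q).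

Lemma geom_tail (R : realType) (P : normedModType R) (u : nat -> P) (M q : R) :
  0 < q < 1 -> (forall k, `|u k| <= M * q ^+ k) ->
  forall k n, `|\sum_(i < k + n) u i - \sum_(i < k) u i| <= M * q ^+ k / (1 - q).
Proof.
move=> /andP[q0 q1] uM k n.
have M0 : 0 <= M by have := le_trans (normr_ge0 _) (uM 0%N); rewrite expr0 mulr1.
have q1' : 0 < 1 - q by lra.
suff : `|\sum_(i < k + n) u i - \sum_(i < k) u i| <= M * q ^+ k * (1 - q ^+ n) / (1 - q).
  move=> /le_trans; apply; rewrite ler_pM2r ?invr_gt0//.
  rewrite ler_piMr//; first by rewrite mulr_ge0// exprn_ge0// ltW.
  by rewrite lerBlDr lerDl exprn_ge0// ltW.
elim: n => [|n IH]; first by rewrite addn0 subrr normr0 expr0 subrr mulr0 mul0r.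
rewrite addnS big_ord_recr/= addrAC; apply: (le_trans (ler_normD _ _)).
apply: (le_trans (lerD IH (uM _))).
rewrite le_eqVlt; apply/orP; left; apply/eqP.
by rewrite exprD exprS; field; rewrite gt_eqF.
Qed.

Lemma geom_complete_cvg (R : realType) (P : normedModType R) (u : nat -> P) (M q : R) l :
  0 < q < 1 -> (forall k, `|u k| <= M * q ^+ k) ->
  (fun k => \sum_(i < k) u i) @ \oo --> l ->
  forall k, `|l - \sum_(i < k) u i| <= M * q ^+ k / (1 - q).
Proof.
move=> q01 uM /cvgrPdist_lt ul k; apply/ler_addgt0Pr => e e0.
have [N _ /(_ (k + N)%N)] := ul e e0.
rewrite /= leq_addl => /(_ isT) lN.
rewrite -(subrKA (\sum_(i < k + N) u i)) (le_trans (ler_normD _ _))//.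
by rewrite addrC lerD ?geom_tail// ltW.
Qed.

Lemma complete_geom (R : realType) (P : completeNormedModType R) :
  geom_complete P.
Proof.
move=> u M q q01 uM; have /andP[q0 q1] := q01.
suff ul : cvgn (fun k => \sum_(i < k) u i).
  exists (limn (fun k => \sum_(i < k) u i)); exact: geom_complete_cvg ul.
have -> : (fun k => \sum_(i < k) u i) = series u.
  by apply/funext => k; rewrite seriesEnat/= big_mkord.
apply: normed_cvg; apply: (@series_le_cvg _ _ (geometric M q)) => // [k|k|]; first exact: normr_ge0.
  exact: le_trans (uM k).
by apply: is_cvg_geometric_series; rewrite ger0_norm// ltW.
Qed.

Lemma geom_complete_prod (R : realType) (P Q : normedModType R) :
  geom_complete P -> geom_complete Q -> geom_complete (P * Q)%type.
Proof.
move=> cP cQ u M q q01 uM.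
have [k|l1 l1P] := cP (fun k => (u k).1) M q q01.
  by apply: le_trans (uM k); rewrite prod_normE le_max lexx.
have [k|l2 l2P] := cQ (fun k => (u k).2) M q q01.
  by apply: le_trans (uM k); rewrite prod_normE le_max lexx orbT.
exists (l1, l2) => k; rewrite prod_normE ge_max/=.
have sE : \sum_(i < k) u i = (\sum_(i < k) (u i).1, \sum_(i < k) (u i).2).
  by elim: k => [|k IH]; rewrite ?big_ord0// !big_ord_recr/= IH.
by rewrite sE; apply/andP; split; [exact: l1P|exact: l2P].
Qed.

Lemma geom_complete_rV (R : realType) n : geom_complete 'rV[R]_n.
Proof.
move=> u M q q01 uM; have /andP[q0 q1] := q01.
have M0 : 0 <= M by have := le_trans (normr_ge0 _) (uM 0%N); rewrite expr0 mulr1.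
have /choice[l lP] : forall j : 'I_n, exists l : R, forall k,
    `|l - \sum_(i < k) u i 0 j| <= M * q ^+ k / (1 - q).
  move=> j; apply: (@complete_geom R R^o (fun i => u i 0 j) M q q01) => k.
  exact: le_trans (rV_norm_ge _ _) (uM k).
exists (\row_j l j) => k; apply: rV_norm_le => [|j].
  by rewrite divr_ge0 ?mulr_ge0 ?exprn_ge0// ?subr_ge0 ltW.
by rewrite !mxE summxE.
Qed.

(** * Bounded functionals and the open mapping theorem *)

Definition bnd (R : realType) (X : normedModType R) (D : set X) (f : X -> R) (c : R) :=
  (forall (a : R) x y, D x -> D y -> f (a *: x + y) = a *: f x + f y) /\
  forall x, D x -> `|f x| <= c * `|x|.

(** Surjectivity onto the dual of [D] with the constant of the open mapping theorem; the preimage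
    need not depend linearly on [f]. *)
Definition open_onto (R : realType) (P X : normedModType R) (D : set X)
    (A : P -> X -> R) (C : R) :=
  forall f c, 0 < c -> bnd D f c -> exists p, `|p| <= C * c /\ forall x, D x -> f x = A p x.

Lemma bounded_linP (R : realType) (X : normedModType R) (D : set X) (f : X -> R) :
  bounded_lin D f <-> exists2 c, 0 < c & bnd D f c.
Proof.
split=> [[lf [c fc]]|[c c0 [lf fc]]]; last by split => //; exists c.
exists (`|c| + 1); first by rewrite ltr_wpDl.
split=> // x Dx; apply: le_trans (fc x Dx) _.
by rewrite ler_wpM2r// (le_trans (ler_norm _))// lerDl.
Qed.

Lemma geom_small (R : realType) (y M q : R) : 0 < q < 1 ->
  (forall k, `|y| <= M * q ^+ k) -> y = 0.
Proof.
move=> /andP[q0 q1] yM; apply/eqP; rewrite -normr_eq0 eq_le normr_ge0 andbT.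
have q1' : `|q| < 1 by rewrite gtr0_norm.
have := @cvg_geometric R M q q1'.
move=> /cvgrPdist_lt cv; apply/ler_addgt0Pr => e e0; rewrite add0r.
have [N _ /(_ N (leqnn N))] := cv e e0.
rewrite /= sub0r normrN => /(le_lt_trans (ler_norm _)) lt.
exact: le_trans (yM N) (ltW lt).
Qed.

Section op_bounded.
Variables (R : realType) (P X Z : normedModType R) (D : set X) (A : P -> X -> Z).
Hypothesis bA : op_bounded_lin setT D A.

Lemma oblP a u v x : D x -> A (a *: u + v) x = a *: A u x + A v x.
Proof. by move=> Dx; exact: bA.1. Qed.

Lemma oblD u v x : D x -> A (u + v) x = A u x + A v x.
Proof. by move=> Dx; rewrite -[u]scale1r oblP// !scale1r. Qed.

Lemma obl0 x : D x -> A 0 x = 0.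
Proof. by move=> Dx; apply: (@addrI _ (A 0 x)); rewrite -oblD// !addr0. Qed.

Lemma oblZ a u x : D x -> A (a *: u) x = a *: A u x.
Proof. by move=> Dx; rewrite -[a *: u]addr0 oblP// obl0// addr0. Qed.

Lemma oblB u v x : D x -> A (u - v) x = A u x - A v x.
Proof. by move=> Dx; rewrite oblD// -scaleN1r oblZ// scaleN1r. Qed.

Lemma obl_sum n (F : 'I_n -> P) x : D x ->
  A (\sum_(i < n) F i) x = \sum_(i < n) A (F i) x.
Proof.
move=> Dx; elim: n F => [F|n IH F]; first by rewrite !big_ord0 obl0.
by rewrite !big_ord_recr/= oblD// IH.
Qed.

Lemma obl_bound : exists2 c : R, 0 < c & forall p x, D x -> `|A p x| <= c * `|p| * `|x|.
Proof.
have [_ [_ [c cP]]] := bA; exists (`|c| + 1); first by rewrite ltr_wpDl.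
move=> p x Dx; apply: le_trans (cP p x _ Dx) _ => //.
by rewrite ler_wpM2r// ler_wpM2r// (le_trans (ler_norm _))// lerDl.
Qed.

End op_bounded.

Lemma op_bounded_lin_sub (R : realType) (P X Z : normedModType R) (S S' : set P)
    (D D' : set X) (T : P -> X -> Z) :
  S `<=` S' -> D `<=` D' -> op_bounded_lin S' D' T -> op_bounded_lin S D T.
Proof.
move=> SS DD [Tl [Tb [c cP]]]; split; [|split].
- by move=> a u v x /SS Su /SS Sv /DD Dx; exact: Tl.
- move=> h /SS Sh; have [hl [d dP]] := Tb h Sh; split; last by exists d => x /DD; exact: dP.
  by move=> a x y /DD Dx /DD Dy; exact: hl.
- by exists c => h x /SS Sh /DD Dx; exact: cP.
Qed.

Section open_mapping.
Variables (R : realType) (P X : normedModType R) (D : set X) (A : P -> X -> R).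
Hypothesis cP : geom_complete P.
Hypothesis sD : lin_subspace D.
Hypothesis bA : op_bounded_lin setT D A.

(** Neumann iteration: each correction halves the residual, so the k-th one has norm at most C c /
    2^k, and the corrections sum to norm at most 2 C c. *)
Lemma open_onto_approx (C : R) :
  (forall f c, 0 < c -> bnd D f c -> exists p, `|p| <= C * c /\
     forall x, D x -> `|f x - A p x| <= c / 2 * `|x|) ->
  open_onto D A (2 * C).
Proof.
move=> approx.
have /choice[s sP] : forall fc : (X -> R) * R, exists p, 0 < fc.2 -> bnd D fc.1 fc.2 ->
    `|p| <= C * fc.2 /\ forall x, D x -> `|fc.1 x - A p x| <= fc.2 / 2 * `|x|.
  move=> [f c]/=; have [c0|c0] := boolP (0 < c); last by exists 0.
  have [b|b] := pselect (bnd D f c); last by exists 0.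
  by have [p pP] := approx f c c0 b; exists p.
move=> f c c0 fc.
pose q : R := 2^-1.
have q01 : 0 < q < 1 by rewrite /q; apply/andP; split; lra.
pose ck k := c * q ^+ k.
have ck0 k : 0 < ck k by rewrite mulr_gt0// exprn_gt0//; case/andP: q01.
pose F := fix F k := if k is k'.+1 then fun x => F k' x - A (s (F k', ck k')) x else f.
pose p k := s (F k, ck k).
have Fb k : bnd D (F k) (ck k).
  elim: k => [|k IH]; first by rewrite /ck expr0 mulr1.
  have [_ sk] := sP (F k, ck k) (ck0 k) IH.
  split=> [a x y Dx Dy|x Dx]/=.
    have [Al _] := bA.2.1 (s (F k, ck k)) I.
    by rewrite IH.1// Al// !scalerBr opprD addrACA.
  by apply: le_trans (sk x Dx) _; rewrite /= /ck exprSr mulrA.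
have pb k : `|p k| <= C * c * q ^+ k.
  by have [+ _] := sP (F k, ck k) (ck0 k) (Fb k); rewrite /= /ck mulrA.
have FE k x : D x -> F k x = f x - A (\sum_(i < k) p i) x.
  move=> Dx; elim: k => [|k IH]/=; first by rewrite big_ord0 (obl0 bA)// subr0.
  by rewrite IH big_ord_recr/= (oblD bA)// opprD addrA.
have [l lP] := cP q01 pb.
exists l; split.
  have := lP 0%N; rewrite big_ord0 subr0 expr0 mulr1 => /le_trans; apply.
  by rewrite le_eqVlt /q; apply/orP; left; apply/eqP; field.
move=> x Dx; apply/eqP; rewrite -subr_eq0; apply/eqP.
have [a a0 aP] := obl_bound bA.
apply: (@geom_small _ _ ((c + a * (C * c * 2)) * `|x|) q) => // k.
have -> : f x - A l x = F k x - A (l - \sum_(i < k) p i) x.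
  by rewrite FE// (oblB bA)//; ring.
apply: le_trans (ler_normB _ _) _.
have := (Fb k).2 x Dx; rewrite /ck => h1.
have := aP (l - \sum_(i < k) p i) x Dx => h2.
have h3 : a * `|l - \sum_(i < k) p i| * `|x| <= a * (C * c * 2) * q ^+ k * `|x|.
  rewrite ler_wpM2r// -!mulrA ler_wpM2l//; first exact: ltW.
  apply: le_trans (lP k) _; rewrite le_eqVlt; apply/orP; left; apply/eqP.
  by rewrite /q; field.
apply: le_trans (lerD h1 (le_trans h2 h3)) _.
by rewrite le_eqVlt; apply/orP; left; apply/eqP; ring.
Qed.

(* Gliding hump: were the constants unbounded, one could add to [F] a multiple [r h]
   that keeps it at distance more than [r / 2] from the image of the ball of radius [k.+1]. *)
Lemma hump_step (bad : R -> X -> R) :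
  (forall C, bnd D (bad C) 1 /\ forall p, `|p| <= C ->
     ~ forall x, D x -> `|bad C x - A p x| <= 2^-1 * `|x|) ->
  forall (F : X -> R) (k : nat) (r : R), 0 < r -> exists h : X -> R, bnd D h r /\
    forall p, `|p| <= k.+1%:R -> ~ forall x, D x -> `|F x + h x - A p x| <= r / 2 * `|x|.
Proof.
move=> badP F k r r0; have [[bl bb] bf] := badP (k.+1%:R / r).
set f := bad _ in bl bb bf.
have bndr (s : R) : `|s| = r -> bnd D (fun x => s * f x) r.
  move=> sr; split=> [a x y Dx Dy|x Dx].
    by rewrite bl// /GRing.scale/=; ring.
  by rewrite normrM sr ler_wpM2l//; [exact: ltW|rewrite -[leRHS]mul1r bb].
have [far|] := pselect (forall p, `|p| <= k.+1%:R ->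
    ~ forall x, D x -> `|F x + r * f x - A p x| <= r / 2 * `|x|).
  by exists (fun x => r * f x); split => //; apply: bndr; rewrite gtr0_norm.
(* If F + r f and F - r f were both that close to images of [p1] and [p2], half their difference
   divided by r would put f within 1/2 of the image of a point of norm at most (k + 1) / r, contrary
   to the choice of f. *)
move=> /existsNP[p1 /not_implyP[p1k /contrapT p1P]].
exists (fun x => - r * f x); split; first by apply: bndr; rewrite normrN gtr0_norm.
move=> p2 p2k p2P; apply: (bf ((2 * r)^-1 *: (p1 - p2))).
  rewrite normrZ gtr0_norm ?invr_gt0 ?mulr_gt0//.
  rewrite ler_pdivrMl ?mulr_gt0//.
  apply: le_trans (ler_normB _ _) _; apply: le_trans (lerD p1k p2k) _.
  by rewrite le_eqVlt; apply/orP; left; apply/eqP; field; rewrite gt_eqF.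
move=> x Dx; rewrite (oblZ bA)// (oblB bA)//.
have -> : f x - (2 * r)^-1 *: (A p1 x - A p2 x) = (2 * r)^-1 *
   ((F x + r * f x - A p1 x) - (F x + - r * f x - A p2 x)).
  by rewrite /GRing.scale/=; field; rewrite gt_eqF.
rewrite normrM gtr0_norm ?invr_gt0 ?mulr_gt0//.
rewrite ler_pdivrMl ?mulr_gt0//.
apply: le_trans (ler_normB _ _) _; apply: le_trans (lerD (p1P x Dx) (p2P x Dx)) _.
by rewrite le_eqVlt; apply/orP; left; apply/eqP; field.
Qed.

(** If no constant solves every functional of bound 1 up to an error 1/2, humps of size 4^-k are
    summed so that each partial sum avoids the image of a larger ball. Their pointwise limit [L] is
    a bounded functional outside the range. *)
Lemma open_mapping :
  (forall f, bounded_lin D f -> exists p, forall x, D x -> f x = A p x) ->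
  exists2 C, 0 < C & open_onto D A C.
Proof.
move=> onto.
have [[C [C0 CP]]|] := pselect (exists C, 0 < C /\ forall f, bnd D f 1 ->
    exists p, `|p| <= C /\ forall x, D x -> `|f x - A p x| <= 2^-1 * `|x|).
  exists (2 * C); first by rewrite mulr_gt0.
  apply: open_onto_approx => f c c0 [fl fb].
  have [|p [pC pP]] := CP (fun x => c^-1 * f x).
    split=> [a x y Dx Dy|x Dx]; first by rewrite fl// /GRing.scale/=; ring.
    by rewrite normrM gtr0_norm ?invr_gt0// ler_pdivrMl// mul1r fb.
  exists (c *: p); split.
    by rewrite normrZ gtr0_norm// mulrC ler_wpM2r// ltW.
  move=> x Dx; rewrite (oblZ bA)//.
  have -> : f x - c *: A p x = c * (c^-1 * f x - A p x).
    by rewrite /GRing.scale/=; field; rewrite gt_eqF.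
  by rewrite normrM gtr0_norm// -!mulrA ler_wpM2l// ?pP// ltW.
move=> nC; exfalso.
have /choice[bad badP] : forall C : R, exists f, bnd D f 1 /\ forall p, `|p| <= C ->
     ~ forall x, D x -> `|f x - A p x| <= 2^-1 * `|x|.
  move=> C; apply: contrapT => nb; apply: nC; exists (`|C| + 1); split.
    by rewrite ltr_wpDl.
  move=> f fb; apply: contrapT => np; apply: nb; exists f; split=> // p pC fp.
  apply: np; exists p; split => //.
  by rewrite (le_trans pC)// (le_trans (ler_norm _))// lerDl.
have q01 : 0 < (4^-1 : R) < 1 by apply/andP; split; lra.
have q0 : 0 < (4^-1 : R) by lra.
have /choice[s sP] : forall Fk : (X -> R) * nat, exists h : X -> R,
    bnd D h (4^-1 ^+ Fk.2) /\
    forall p, `|p| <= Fk.2.+1%:R ->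
      ~ forall x, D x -> `|Fk.1 x + h x - A p x| <= 4^-1 ^+ Fk.2 / 2 * `|x|.
  by move=> [F k]; apply: (hump_step badP); rewrite exprn_gt0.
pose F := fix F k := if k is k'.+1 then fun x => F k' x + s (F k', k') x else fun=> 0.
pose h k := s (F k, k).
have FE k x : F k x = \sum_(i < k) h i x.
  by elim: k => [|k IH]; rewrite ?big_ord0// big_ord_recr/= IH.
have Fl k a x y : D x -> D y -> F k (a *: x + y) = a *: F k x + F k y.
  move=> Dx Dy; elim: k => [|k IH]/=; first by rewrite scaler0 addr0.
  by rewrite IH (sP (F k, k)).1.1// scalerDr addrACA.
have /choice[L LP] : forall x, exists l, D x -> forall k,
    `|l - F k x| <= `|x| * 4^-1 ^+ k / (1 - 4^-1).
  move=> x; have [Dx|] := pselect (D x); last by exists 0.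
  have [|l lP] := @complete_geom R R^o (fun i => h i x) (`|x|) _ q01.
    by move=> k; rewrite mulrC; apply: (sP (F k, k)).1.2.
  by exists l => _ k; rewrite FE.
have [|p pP] := onto L.
  split=> [a x y Dx Dy|].
    apply/eqP; rewrite -subr_eq0; apply/eqP.
    have Dz : D (a *: x + y) by exact: sD.2.
    apply: (@geom_small _ _ ((`|a *: x + y| + `|a| * `|x| + `|y|) / (1 - 4^-1)) _ q01) => k.
    have -> : L (a *: x + y) - (a *: L x + L y) =
        (L (a *: x + y) - F k (a *: x + y)) - (a * (L x - F k x) + (L y - F k y)).
      by rewrite Fl// /GRing.scale/=; ring.
    apply: le_trans (ler_normB _ _) _; apply: le_trans (lerD (LP _ Dz k) (ler_normD _ _)) _.
    rewrite normrM.
    apply: le_trans (lerD (lexx _) (lerD (ler_wpM2l (normr_ge0 a) (LP _ Dx k)) (LP _ Dy k))) _.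
    by rewrite le_eqVlt; apply/orP; left; apply/eqP; ring.
  exists (1 - 4^-1)^-1 => x Dx.
  have := LP x Dx 0%N; rewrite /= subr0 expr0 mulr1 => /le_trans; apply.
  by rewrite mulrC.
have [k _ pk] : exists2 k : nat, True & `|p| <= k.+1%:R.
  exists (Num.bound `|p|) => //; rewrite (le_trans (ltW (archi_boundP _)))// ler_nat.
  exact: leqnSn.
apply: ((sP (F k, k)).2 p pk) => x Dx /=.
(* The humps after the k-th add up to at most 4^-k / 3, less than the distance 4^-k / 2 secured at
   step k; this is why the ratio has to be below 1/3. *)
rewrite -pP//; have := LP x Dx k.+1; rewrite distrC /= => /le_trans; apply.
rewrite exprS.
have -> : `|x| * (4^-1 * 4^-1 ^+ k) / (1 - 4^-1) = 4^-1 ^+ k * `|x| / 3 :> R by field.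
have t0 := mulr_ge0 (ltW (exprn_gt0 k q0)) (normr_ge0 x).
rewrite [leRHS]mulrAC; lra.
Qed.
End open_mapping.

(** * Finite-dimensional subspaces *)

Definition indep (R : realType) (P : normedModType R) n (b : 'I_n -> P) :=
  forall c : 'I_n -> R, \sum_(i < n) c i *: b i = 0 -> forall i, c i = 0.

Lemma lin_fun0 (R : pzRingType) (U V : lmodType R) (F : U -> V) :
  (forall a u v, F (a *: u + v) = a *: F u + F v) -> F 0 = 0.
Proof. by move=> Fl; apply: (@addrI _ (F 0)); rewrite -[X in X + _]scale1r -Fl scale1r !addr0. Qed.

Lemma lin_fun_sum (R : pzRingType) (U V : lmodType R) (F : U -> V) m (c : 'I_m -> R) (p : 'I_m -> U) :
  (forall a u v, F (a *: u + v) = a *: F u + F v) ->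
  F (\sum_(i < m) c i *: p i) = \sum_(i < m) c i *: F (p i).
Proof.
move=> Fl; elim: m c p => [|m IH] c p; first by rewrite !big_ord0 lin_fun0.
by rewrite !big_ord_recl Fl IH.
Qed.

Lemma lin_subspace_sum (R : realType) (P : normedModType R) (W : set P) n
    (c : 'I_n -> R) (b : 'I_n -> P) :
  lin_subspace W -> (forall i, W (b i)) -> W (\sum_(i < n) c i *: b i).
Proof.
move=> [W0 WD] bW; elim: n c b bW => [|n IH] c b bW; first by rewrite big_ord0.
by rewrite big_ord_recl; apply: WD => //; apply: IH => i; apply: bW.
Qed.

(** Equivalence of norms: on the compact unit sphere of coefficients the norm of the combination
    attains its minimum, which independence makes positive. *)
Lemma indep_norm (R : realType) (P : normedModType R) n (b : 'I_n -> P) : indep b ->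
  exists2 k : R, 0 < k & forall (c : 'I_n -> R) i, k * `|c i| <= `|\sum_(j < n) c j *: b j|.
Proof.
case: n b => [|n] b ib; first by exists 1 => // c [].
pose f (v : 'rV[R]_n.+1) := `|\sum_(j < n.+1) v 0 j *: b j|.
have cf : continuous f.
  move=> v; apply/(@cvgrPdist_lt _ _ _ (nbhs v) _ f) => e e0.
  pose K := 1 + \sum_j `|b j|.
  have K0 : 0 < K by rewrite ltr_pwDl// sumr_ge0.
  have : \forall w \near v, `|v - w| < e / K.
    have eK : 0 < e / K by rewrite divr_gt0.
    exact: ((@cvgrPdist_lt _ _ _ (nbhs v) _ id v).1 (@cvg_id _ _) _ eK).
  apply: filterS => w; rewrite ltr_pdivlMr// => vw.
  apply: le_lt_trans (ler_dist_dist _ _) _; rewrite -sumrB; apply: le_lt_trans vw => /=.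
  apply: le_trans (ler_norm_sum _ _ _) _.
  rewrite mulrC /K mulrDl mul1r mulr_suml -[leLHS]add0r lerD//; apply: ler_sum => j _.
  rewrite -scalerBl normrZ [leLHS]mulrC ler_wpM2l//.
  by have := rV_norm_ge (v - w) j; rewrite !mxE.
pose S := [set v : 'rV[R]_n.+1 | `|v| = 1].
have cS : compact S.
  apply: bounded_closed_compact.
    by exists 1; split; [exact: num_real|move=> M M1 v /= ->; exact: ltW].
  rewrite (_ : S = (fun v : 'rV[R]_n.+1 => `|v|) @^-1` [set 1]) //.
  apply: preimage_closed; last exact: closed_eq.
  by move=> v _; exact: norm_continuous.
have n1 (z : 'rV[R]_n.+1) : z != 0 -> S (`|z|^-1 *: z).
  by move=> z0; rewrite /S/= normrZ ger0_norm ?invr_ge0// mulVf// normr_eq0.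
have S0 : S !=set0.
  exists (`|const_mx 1 : 'rV[R]_n.+1|^-1 *: const_mx 1); apply: n1.
  by apply/eqP => /matrixP/(_ 0 0); rewrite !mxE => /eqP; rewrite oner_eq0.
have [v /set_mem vS vmin] := EVT_min_rV S0 cS (continuous_subspaceT cf).
have fv : 0 < f v.
  rewrite lt_neqAle normr_ge0 andbT eq_sym normr_eq0; apply/eqP => /ib v0.
  have : v = 0 by apply/rowP => j; rewrite mxE; exact: v0.
  by move=> v0'; move: vS; rewrite /S/= v0' normr0 => /eqP; rewrite eq_sym oner_eq0.
exists (f v) => // c i.
pose z := \row_j c j : 'rV[R]_n.+1.
have [z0|z0] := eqVneq z 0.
  have -> : c i = 0 by have := congr1 (fun z : 'rV_n.+1 => z 0 i) z0; rewrite !mxE.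
  by rewrite normr0 mulr0.
have := vmin _ (mem_set (n1 _ z0)).
have -> : f (`|z|^-1 *: z) = `|z|^-1 * `|\sum_(j < n.+1) c j *: b j|.
  rewrite /f -[X in X * _]ger0_norm ?invr_ge0// -normrZ scaler_sumr.
  by congr (`| _ |); apply: eq_bigr => j _; rewrite !mxE scalerA.
rewrite ler_pdivlMl ?normr_gt0// => /(le_trans _); apply; rewrite mulrC.
by rewrite ler_wpM2r//; [exact: ltW|have := rV_norm_ge z i; rewrite mxE].
Qed.

Lemma det_replace_row (R : comNzRingType) k (c : 'rV[R]_k) (i : 'I_k) :
  \det (\matrix_(a, j) if a == i then c 0 j else (a == j)%:R) = c 0 i.
Proof.
rewrite (expand_det_col _ i) (bigD1 i)//= !mxE eqxx big1 ?addr0; last first.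
  by move=> j ji; rewrite !mxE (negbTE ji) mul0r.
rewrite /cofactor -signr_odd oddD addbb expr0 mul1r.
rewrite (_ : row' i _ = 1%:M) ?det1 ?mulr1//.
apply/matrixP => a j; rewrite !mxE eq_sym (negbTE (neq_lift _ _)).
by rewrite (inj_eq lift_inj).
Qed.

(* Maximizing the determinant of the coordinate matrix, up to a factor 2, over the families
   of vectors of norm at most 1 yields an approximate Auerbach basis, by Cramer's rule. *)
Lemma near_auerbach (R : realType) (P : normedModType R) k (b : 'I_k -> P) : indep b ->
  exists2 C : 'M[R]_k, forall i, `|\sum_j C i j *: b j| <= 1 &
    forall (c : 'I_k -> R) i, `|c i| <= 2 * `|\sum_i c i *: \sum_j C i j *: b j|.
Proof.
move=> ib; have [kap kap0 kapP] := indep_norm ib.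
pose ok (C : 'M[R]_k) := forall i, `|\sum_j C i j *: b j| <= 1.
pose E := [set d | exists2 C, ok C & d = \det C].
have Eub : ubound E (\sum_(s : 'S_k) \prod_(i < k) kap^-1).
  move=> _ [C okC ->]; rewrite (le_trans (ler_norm _))//.
  rewrite (le_trans (ler_norm_sum _ _ _))//; apply: ler_sum => s _.
  rewrite normrM normrX normrN1 expr1n mul1r normr_prod; apply: ler_prod => i _.
  rewrite normr_ge0/= -[leRHS]mul1r ler_pdivlMr// mulrC.
  exact: le_trans (kapP (fun j => C i j) (s i)) (okC i).
(* Scaling [b] by [t] gives an admissible family with determinant t^k > 0, so the supremum is
   positive and half of it can be exceeded. *)
pose t := (1 + \sum_j `|b j|)^-1.
have t0 : 0 < t by rewrite invr_gt0 ltr_pwDl// sumr_ge0.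
have Et : E (t ^+ k).
  exists (t%:M); last by rewrite det_scalar.
  move=> i; rewrite (bigD1 i)//= big1 => [|j ji]; last by rewrite mxE eq_sym (negbTE ji) scale0r.
  rewrite addr0 mxE eqxx mulr1n normrZ gtr0_norm// ler_pdivrMl ?mulr1; last first.
    by rewrite ltr_pwDl// sumr_ge0.
  by rewrite (bigD1 i)//= addrCA lerDl addr_ge0// sumr_ge0.
have supE : has_sup E by split; [exists (t ^+ k)|eexists; exact: Eub].
have s0 : 0 < sup E by rewrite (lt_le_trans (exprn_gt0 k t0))// ub_le_sup//; case: supE.
have [|_ [C okC ->] dC] := @sup_adherent _ E (sup E / 2) _ supE; first by rewrite divr_gt0.
exists C => //.
have main (c : 'I_k -> R) i : c i <= 2 * `|\sum_i c i *: \sum_j C i j *: b j|.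
  apply/ler_addgt0Pr => e e0; set v := \sum_i _.
  pose r := `|v| + e / 2.
  have r0 : 0 < r by rewrite ltr_wpDl// divr_gt0.
  (* The i-th vector is replaced by v / r, admissible since |v| <= r. The determinant gets
     multiplied by c_i / r and stays below 2 det C, so c_i <= 2 r = 2 |v| + e. The extra e / 2 in
     [r] covers v = 0. *)
  pose M : 'M[R]_k := \matrix_(a, j) if a == i then (r^-1 *: \row_j c j : 'rV_k) 0 j else (a == j)%:R.
  have MC a : \sum_j (M *m C) a j *: b j = \sum_l M a l *: \sum_j C l j *: b j.
    under eq_bigr do rewrite mxE scaler_suml.
    rewrite exchange_big/=; apply: eq_bigr => l _; rewrite scaler_sumr.
    by apply: eq_bigr => j _; rewrite scalerA.
  have okM : ok (M *m C).
    move=> a; rewrite MC; have [->|ai] := eqVneq a i.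
      under eq_bigr => j _ do rewrite mxE eqxx [_ 0 j]mxE [X in _ * X]mxE -scalerA.
      rewrite -scaler_sumr -/v normrZ gtr0_norm ?invr_gt0// ler_pdivrMl// mulr1.
      by rewrite lerDl divr_ge0// ltW.
    rewrite (bigD1 a)//= [X in _ + X]big1 => [|j ja]; last first.
      by rewrite mxE (negbTE ai) eq_sym (negbTE ja) scale0r.
    by rewrite addr0 mxE (negbTE ai) eqxx scale1r.
  have : \det (M *m C) <= sup E by apply: ub_le_sup; [case: supE|exists (M *m C)].
  rewrite det_mulmx det_replace_row !mxE => le1.
  have dC0 : 0 < \det C by lra.
  have : r^-1 * c i * \det C <= 2 * \det C by lra.
  by rewrite ler_pM2r// ler_pdivrMl// /r => h; lra.
move=> c i; rewrite ler_norml main andbT.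
have := main (fun i => - c i) i; under eq_bigr do rewrite scaleNr.
by rewrite sumrN normrN => h; lra.
Qed.

(** If k > n, the approximants in [W'] of a near Auerbach basis satisfy a nontrivial relation with
    coefficients a. The same combination of the basis then has norm at most k theta |a|, and the
    Auerbach bound yields |a| <= 2 k theta |a| < |a|. *)
Lemma gap_card (R : realType) (P : normedModType R) (W W' : set P) k n (b : 'I_k -> P)
    (theta : R) :
  lin_subspace W -> (forall i, W (b i)) -> indep b -> dim_eq W' n ->
  0 <= theta -> theta * (2 * k%:R) < 1 ->
  (forall p, W p -> exists2 p', W' p' & `|p - p'| <= theta * `|p|) ->
  (k <= n)%N.
Proof.
move=> sW bW ib [b' [_ [_ b'span]]] th0 thk gap.
have [C C1 CP] := near_auerbach ib.
pose e i := \sum_j C i j *: b j.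
have /choice[y yP] : forall i, exists y, W' y /\ `|e i - y| <= theta.
  move=> i; have [|y Wy ey] := gap (e i); first exact: lin_subspace_sum.
  exists y; split => //; apply: le_trans ey _.
  by rewrite -[leRHS]mulr1 ler_wpM2l// C1.
have /choice[Y YP] : forall i, exists Y : 'I_n -> R, y i = \sum_j Y j *: b' j.
  by move=> i; have [c cE] := b'span _ (yP i).1; exists c.
rewrite leqNgt; apply/negP => nk.
pose MY := \matrix_(i < k, j < n) Y i j.
have ker0 : kermx MY != 0.
  rewrite kermx_eq0 /row_free; apply/negP => /eqP rk.
  by have := rank_leq_col MY; rewrite rk leqNgt nk.
have /rowV0Pn[a /sub_kermxP aMY a0] := ker0.
have ay : \sum_i a 0 i *: y i = 0.
  under eq_bigr do rewrite YP scaler_sumr.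
  rewrite exchange_big/= big1// => j _.
  under eq_bigr do rewrite scalerA.
  rewrite -scaler_suml.
  have := congr1 (fun z : 'rV_n => z 0 j) aMY; rewrite !mxE.
  by under eq_bigr do rewrite mxE; move=> ->; rewrite scale0r.
have bound : `|\sum_i a 0 i *: e i| <= k%:R * (`|a| * theta).
  have -> : \sum_i a 0 i *: e i = \sum_i a 0 i *: (e i - y i).
    by under [RHS]eq_bigr do rewrite scalerBr; rewrite sumrB ay subr0.
  apply: le_trans (ler_norm_sum _ _ _) _.
  rewrite mulr_natl -[X in _ *+ X]card_ord -sumr_const; apply: ler_sum => i _.
  by rewrite normrZ ler_pM ?rV_norm_ge// (yP i).2.
have : `|a| <= 2 * (k%:R * (`|a| * theta)).
  apply: rV_norm_le => [|j]; first by rewrite !mulr_ge0.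
  by apply: le_trans (CP (fun i => a 0 i) j) _; rewrite ler_wpM2l.
rewrite leNgt; apply/negP/negPn.
have -> : 2 * (k%:R * (`|a| * theta)) = theta * (2 * k%:R) * `|a| by ring.
by rewrite -[ltRHS]mul1r ltr_pM2r// normr_gt0.
Qed.

(** This dichotomy makes a subspace finite-dimensional as soon as [N] independent vectors in it are
    excluded. *)
Lemma dim_eq_or_indep (R : realType) (P : normedModType R) (W : set P) N :
  (exists2 n, (n < N)%N & dim_eq W n) \/
  (exists2 b : 'I_N -> P, forall i, W (b i) & indep b).
Proof.
elim: N => [|N [[n nN nW]|[b bW ib]]].
- by right; exists (fun=> 0) => [[]//|c _ []].
- by left; exists n => //; exact: ltnW.
have [span|] := pselect (forall h, W h -> exists c : 'I_N -> R, h = \sum_(i < N) c i *: b i).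
  by left; exists N => //; exists b.
move=> /existsNP[h /not_implyP[Wh nspan]]; right.
exists (fun i => if unlift ord0 i is Some j then b j else h) => [i|c].
  by case: unliftP => //.
rewrite big_ord_recl unlift_none; under eq_bigr do rewrite liftK.
have [c0|c0] := eqVneq (c ord0) 0.
  rewrite c0 scale0r add0r => /ib cl i.
  by have [j ->|->//] := unliftP ord0 i; exact: cl.
move=> /eqP; rewrite addr_eq0 => /eqP hE; exfalso; apply: nspan.
exists (fun i => - ((c ord0)^-1 * c (lift ord0 i))).
rewrite -[LHS](scalerK c0) hE scalerN scaler_sumr -sumrN.
by apply: eq_bigr => i _; rewrite scalerA scaleNr.
Qed.

(** Rank-nullity. It counts the kernel twice: after adding functionals, and after shrinking the
    space of test vectors. *)
Lemma dim_ext (R : realType) (P : normedModType R) (W : set P) n k (L : P -> 'rV[R]_k) :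
  lin_subspace W -> (forall a p q, L (a *: p + q) = a *: L p + L q) ->
  (forall z, exists2 p, W p & L p = z) ->
  dim_eq [set p | W p /\ L p = 0] n -> dim_eq W (n + k).
Proof.
move=> sW Ll Lonto [b [bK [ib bspan]]].
have L0 : L 0 = 0 by exact: lin_fun0.
have /choice[q qP] : forall j : 'I_k, exists q, W q /\ L q = delta_mx 0 j.
  by move=> j; have [q Wq Lq] := Lonto (delta_mx 0 j); exists q.
have Lq (d : 'I_k -> R) : L (\sum_j d j *: q j) = \row_j d j.
  rewrite lin_fun_sum//; under eq_bigr do rewrite (qP _).2.
  by rewrite [RHS]row_sum_delta; apply: eq_bigr => j _; rewrite mxE.
pose e (i : 'I_(n + k)) := match fintype.split i with inl a => b a | inr j => q j end.
have eE (c : 'I_(n + k) -> R) : \sum_i c i *: e i =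
    \sum_i c (lshift k i) *: b i + \sum_j c (rshift n j) *: q j.
  rewrite big_split_ord/=; congr (_ + _); apply: eq_bigr => i _; rewrite /e.
    by rewrite (unsplitK (inl i)).
  by rewrite (unsplitK (inr i)).
have Lb (c : 'I_n -> R) : L (\sum_i c i *: b i) = 0.
  by rewrite lin_fun_sum// big1// => i _; rewrite (bK i).2 scaler0.
exists e; split; [|split].
- by move=> i; rewrite /e; case: fintype.split => j; [case: (bK j)|case: (qP j)].
- move=> c; rewrite eE => c0.
  have d0 j : c (rshift n j) = 0.
    have := congr1 L c0.
    rewrite -[X in X + _]scale1r Ll Lb scaler0 add0r L0 Lq => /matrixP/(_ 0 j).
    by rewrite !mxE.
  move: c0; rewrite [X in _ + X]big1 ?addr0 => [|j _]; last by rewrite d0 scale0r.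
  by move=> /ib c0 i; rewrite -(splitK i); case: fintype.split => j /=.
- move=> h Wh.
  pose h' := \sum_j L h 0 j *: q j.
  have Lh' : L h' = L h by rewrite Lq; apply/rowP => j; rewrite mxE.
  have [|c cE] := bspan (h - h').
    split; last by rewrite addrC -scaleN1r Ll scaleN1r Lh' addNr.
    rewrite addrC -scaleN1r; apply: sW.2 => //.
    by apply: lin_subspace_sum => // j; case: (qP j).
  exists (fun i => match fintype.split i with inl a => c a | inr j => L h 0 j end).
  rewrite eE; under eq_bigr do rewrite (unsplitK (inl _)).
  rewrite -cE; under eq_bigr do rewrite (unsplitK (inr _)).
  by rewrite subrK.
Qed.

(** * Compact perturbations *)

(** Without a finite net, each [v n] can be chosen at distance more than e from the images of all
    earlier ones, collected in [l n]. Two terms of a convergent subsequence within e / 2 of the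
    limit contradict this. *)
Lemma compact_op_net (R : realType) (P X Z : normedModType R) (K : P -> X -> Z) (e : R) :
  compact_op K -> 0 < e -> exists k (v : 'I_k -> P),
    forall u, `|u| <= 1 -> exists i, forall x, `|K u x - K (v i) x| <= e * `|x|.
Proof.
move=> cK e0; apply: contrapT => nonet.
pose far u v := ~ forall x, `|K u x - K v x| <= e * `|x|.
have /choice[c cP] : forall s : seq P, exists u, `|u| <= 1 /\ forall v, v \in s -> far u v.
  move=> s; apply: contrapT => ns; apply: nonet.
  exists (size s), (fun i => nth 0 s i) => u u1; apply: contrapT => nu; apply: ns.
  exists u; split => // v vs close; apply: nu.
  by exists (Ordinal (etrans (index_mem v s) vs)) => x; rewrite /= nth_index.
pose l := fix l n := if n is n'.+1 then c (l n') :: l n' else [::].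
pose v n := c (l n).
have vl j n : (j < n)%N -> v j \in l n.
  elim: n => //= n IH; rewrite ltnS leq_eqVlt inE => /predU1P[->|jn].
    by rewrite eqxx.
  by rewrite IH// orbT.
have [sg [L [sgI [_ sgL]]]] := cK v (fun n => (cP (l n)).1).
have [N /(_ _ _) NP] := sgL (e / 2) (divr_gt0 e0 (ltr0Sn _ _)).
apply: ((cP (l (sg N.+1))).2 _ (vl _ _ (sgI N))) => x.
rewrite -(subrKA (L x)) (le_trans (ler_normD _ _))//.
have h1 := NP N.+1 (leqnSn N) x.
have h2 := NP N (leqnn N) x.
rewrite [X in _ + X]distrC (le_trans (lerD h1 h2))//.
by rewrite -mulrDl -splitr.
Qed.

Definition aug (R : realType) (P X : normedModType R) k (A : P -> X -> R)
    (g : 'I_k -> X -> R) (p : P * 'rV[R]_k) (x : X) : R :=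
  A p.1 x + \sum_j p.2 0 j * g j x.

Definition opker (R : realType) (P X : normedModType R) (D : set X) (A : P -> X -> R) :=
  [set p | forall x, D x -> A p x = 0].

Lemma bounded_linD (R : realType) (X : normedModType R) (D : set X) (f g : X -> R) (a : R) :
  bounded_lin D f -> bounded_lin D g -> bounded_lin D (fun x => f x + a * g x).
Proof.
move=> /bounded_linP[c c0 [fl fb]] /bounded_linP[d d0 [gl gb]]; split.
  by move=> b x y Dx Dy; rewrite fl// gl// /GRing.scale/=; ring.
exists (c + `|a| * d) => x Dx; rewrite (le_trans (ler_normD _ _))// mulrDl lerD ?fb//.
by rewrite normrM -mulrA ler_wpM2l// gb.
Qed.

Lemma bounded_lin_sum (R : realType) (X : normedModType R) (D : set X) k
    (g : 'I_k -> X -> R) (a : 'I_k -> R) :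
  (forall j, bounded_lin D (g j)) -> bounded_lin D (fun x => \sum_j a j * g j x).
Proof.
elim: k g a => [|k IH] g a gb.
  split=> [b x y _ _|]; first by rewrite !big_ord0 scaler0 addr0.
  by exists 0 => x _; rewrite big_ord0 normr0 mul0r.
have -> : (fun x => \sum_j a j * g j x) =
    (fun x => \sum_j a (lift ord0 j) * g (lift ord0 j) x + a ord0 * g ord0 x).
  by apply/funext => x; rewrite big_ord_recl addrC.
by apply: bounded_linD; [exact: IH|exact: gb].
Qed.

Lemma op_bounded_linD (R : realType) (P X : normedModType R) (S : set P) (D : set X)
    (A K : P -> X -> R) (t : R) :
  op_bounded_lin S D A -> op_bounded_lin S D K ->
  op_bounded_lin S D (fun p x => A p x + t * K p x).
Proof.
move=> [Al [Ab [a aP]]] [Kl [Kb [b bP]]]; split; [|split].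
- move=> s u v x Su Sv Dx; rewrite Al// Kl// /GRing.scale/=; ring.
- by move=> h Sh; apply: bounded_linD; [exact: Ab|exact: Kb].
- exists (a + `|t| * b) => h x Sh Dx.
  rewrite (le_trans (ler_normD _ _))// -mulrA mulrDl lerD//; first by rewrite mulrA aP.
  by rewrite normrM -mulrA ler_wpM2l// mulrA bP.
Qed.

Lemma op_bounded_lin_aug (R : realType) (P X : normedModType R) k (D : set X)
    (A : P -> X -> R) (g : 'I_k -> X -> R) :
  op_bounded_lin setT D A -> (forall j, bounded_lin D (g j)) ->
  op_bounded_lin setT D (aug A g).
Proof.
move=> bA bg; have [Al [Ab _]] := bA; have [a a0 aP] := obl_bound bA.
have /choice[c cP] : forall j, exists c, forall x, D x -> `|g j x| <= c * `|x|.
  by move=> j; case: (bg j) => _ [c cP]; exists c.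
have n1 (p : P * 'rV[R]_k) : `|p.1| <= `|p| by rewrite prod_normE le_max lexx.
have n2 (p : P * 'rV[R]_k) : `|p.2| <= `|p| by rewrite prod_normE le_max lexx orbT.
split; [|split].
- move=> s u v x _ _ Dx; rewrite /aug/= Al// scalerDr addrACA; congr (_ + _).
  rewrite scaler_sumr -big_split/=; apply: eq_bigr => j _.
  by rewrite !mxE /GRing.scale/=; ring.
- move=> p _; rewrite /aug.
  have := bounded_linD 1 (Ab p.1 I) (bounded_lin_sum (fun j => p.2 0 j) bg).
  by under eq_fun do rewrite mul1r.
- exists (a + \sum_j `|c j|) => p x _ Dx; rewrite /aug (le_trans (ler_normD _ _))//.
  rewrite -mulrA mulrDl lerD//.
    by rewrite (le_trans (aP _ _ Dx))// -mulrA ler_wpM2l ?(ltW a0)// ler_wpM2r.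
  rewrite (le_trans (ler_norm_sum _ _ _))// mulr_suml; apply: ler_sum => j _.
  rewrite normrM mulrCA ler_pM//.
    exact: le_trans (rV_norm_ge _ _) (n2 p).
  by rewrite (le_trans (cP j x Dx))// ler_wpM2r// ler_norm.
Qed.

Lemma op_bounded_lin_fst (R : realType) (P Q X : normedModType R) (D : set X)
    (K : P -> X -> R) :
  op_bounded_lin setT D K -> op_bounded_lin setT D (fun p : P * Q => K p.1).
Proof.
move=> bK; have [b b0 bP] := obl_bound bK; split; [|split].
- by move=> a u v x _ _ Dx; rewrite -(oblP bK).
- by move=> p _; apply: bK.2.1.
- exists b => p x _ Dx; rewrite (le_trans (bP _ _ Dx))// ler_wpM2r// ler_wpM2l ?(ltW b0)//.
  by rewrite prod_normE le_max lexx.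
Qed.

Lemma sum_pair0 (R : realType) (P Q : normedModType R) m (c : 'I_m -> R) (q : 'I_m -> P) :
  \sum_i c i *: (q i, 0 : Q) = (\sum_i c i *: q i, 0).
Proof.
apply/esym/(@lin_fun_sum R P _ (fun u => (u, 0))) => a u v.
by congr (_, _); rewrite /= scaler0 addr0.
Qed.

Lemma open_onto_aug (R : realType) (P X : normedModType R) k (D : set X)
    (A K : P -> X -> R) (g : 'I_k -> X -> R) (C t : R) :
  geom_complete P -> op_bounded_lin setT D A -> op_bounded_lin setT D K ->
  (forall j, bounded_lin D (g j)) -> 0 < C -> open_onto D A C ->
  (forall p, `|p| <= 1 -> exists i, forall x, D x ->
     `|K p x - g i x| <= (2 * C)^-1 * `|x|) ->
  0 <= t <= 1 -> open_onto D (aug (fun p x => A p x + t * K p x) g) (2 * C).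
Proof.
move=> cP bA bK bg C0 onA net /andP[t0 t1].
apply: open_onto_approx; first exact: geom_complete_prod cP (@geom_complete_rV _ _).
  by apply: op_bounded_lin_aug => //; exact: op_bounded_linD.
move=> f c c0 fb; have [p [pC pf]] := onA f c c0 fb.
pose s := C * c; have s0 : 0 < s by rewrite mulr_gt0.
have ts : `|t * s| <= s by rewrite normrM (ger0_norm t0) (gtr0_norm s0) ler_piMl// ltW.
have [|i iP] := net (s^-1 *: p).
  by rewrite normrZ gtr0_norm ?invr_gt0// ler_pdivrMl// mulr1.
(* As s = C c bounds |p|, the net approximates K (p / s) by g_i up to 1 / (2 C). The added
   coefficient cancels t K p up to t s / (2 C) <= c / 2, the error allowed in the Neumann
   iteration. *)
exists (p, - (t * s) *: delta_mx 0 i); split.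
  rewrite prod_normE ge_max/= pC/=; apply: rV_norm_le => [|j]; first exact: ltW.
  rewrite !mxE eqxx/=; case: (j == i); rewrite ?mulr0 ?normr0 ?mulr1; last exact: ltW.
  by rewrite normrN.
move=> x Dx; rewrite /aug/= (bigD1 i)//= big1 => [|j ji]; last first.
  by rewrite !mxE (negbTE ji) mulr0 mul0r.
rewrite !mxE !eqxx mulr1 addr0 pf//.
have := iP x Dx; rewrite (oblZ bK)//.
have -> : A p x - (A p x + t * K p x + - (t * s) * g i x) =
   - (t * s) * (s^-1 *: K p x - g i x).
  by rewrite /GRing.scale/=; field; rewrite gt_eqF.
move=> le1; rewrite normrM normrN.
apply: le_trans (ler_pM _ _ ts le1) _ => //.
rewrite le_eqVlt; apply/orP; left; apply/eqP; rewrite /s; field.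
by rewrite gt_eqF.
Qed.

Lemma lin_subspace_opker (R : realType) (P X : normedModType R) (D : set X)
    (A : P -> X -> R) : op_bounded_lin setT D A -> lin_subspace (opker D A).
Proof.
move=> bA; split=> [x Dx|a u v Au Av x Dx]; first by rewrite (obl0 bA).
by rewrite (oblP bA)// Au// Av// scaler0 addr0.
Qed.

Section homotopy.
Variables (R : realType) (P X : normedModType R) (D : set X) (A K : P -> X -> R).
Variables (C : R) (N : nat).
Let At (t : R) := fun p x => A p x + t * K p x.
Hypothesis C0 : 0 < C.
Hypothesis bA : op_bounded_lin setT D A.
Hypothesis bK : op_bounded_lin setT D K.
Hypothesis onAt : forall t, 0 <= t <= 1 -> open_onto D (At t) C.

Let bAt t : op_bounded_lin setT D (At t).
Proof. exact: op_bounded_linD. Qed.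

(** On the kernel for s the operator for t equals (t - s) K p, hence is small. Solving for this
    value with constant [C] gives the correction [q] that moves p into the kernel for t. The case p
    = 0 is separate because [open_onto] asks for a positive bound. *)
Lemma opker_gap a s t d : 0 < d -> `|t - s| <= d -> 0 < a ->
  (forall p x, D x -> `|K p x| <= a * `|p| * `|x|) -> 0 <= t <= 1 ->
  forall p, opker D (At s) p ->
    exists2 p', opker D (At t) p' & `|p - p'| <= C * d * a * `|p|.
Proof.
move=> d0 std a0 aP t01 p ps.
have [->|p0] := eqVneq p 0.
  exists 0; first by move=> x Dx; rewrite (obl0 (bAt t)).
  by rewrite subrr normr0 mulr0.
have pE x : D x -> At t p x = (t - s) * K p x.
  by move=> /ps; rewrite /At => h; rewrite mulrBl -[RHS]addr0 -h; ring.
have [||q [qC qE]] := onAt t01 (f := At t p) (c := d * a * `|p|).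
- by rewrite !mulr_gt0// normr_gt0.
- split=> [b x y Dx Dy|x Dx]; first by rewrite ((bAt t).2.1 p I).1.
  by rewrite pE// normrM -!mulrA ler_pM// mulrA aP.
exists (p - q); first by move=> x Dx; rewrite (oblB (bAt t))// qE// subrr.
by rewrite opprB addrC subrK (le_trans qC)// !mulrA.
Qed.

Lemma opker_dim_homotopy : dim_eq (opker D (At 0)) N -> dim_eq (opker D (At 1)) N.
Proof.
move=> dim0; have [a a0 aP] := obl_bound bK.
(* Kernels at neighbouring nodes i / M have gap at most C a / M. Taking M > B makes this admissible
   in [gap_card] for families of up to N + 1 vectors: one more than [N], to exclude a larger kernel
   at the next node. *)
pose B := C * a * (2 * N.+1%:R).
pose M := Num.bound B.
have B0 : 0 < B by rewrite !mulr_gt0// ltr0n.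
have BM : B < M%:R by apply: archi_boundP; exact: ltW.
have M0 : 0 < M%:R :> R by exact: lt_trans BM.
have th (k : nat) : (k <= N.+1)%N -> C * M%:R^-1 * a * (2 * k%:R) < 1.
  move=> kN; have : C * M%:R^-1 * a * (2 * k%:R) <= B / M%:R.
    rewrite /B [leRHS]mulrC !mulrA ler_pM ?mulr_ge0 ?invr_ge0 ?(ltW C0) ?(ltW a0) ?(ltW M0)//.
      by rewrite le_eqVlt; apply/orP; left; apply/eqP; ring.
    by rewrite ler_nat.
  by move=> /le_lt_trans; apply; rewrite ltr_pdivrMr// mul1r.
have th0 : 0 <= C * M%:R^-1 * a by rewrite !mulr_ge0 ?invr_ge0 ?ltW.
suff main i : (i <= M)%N -> dim_eq (opker D (At (i%:R / M%:R))) N.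
  by have := main M (leqnn M); rewrite divff ?gt_eqF.
elim: i => [_|i IH iM]; first by rewrite mul0r.
have {}IH := IH (ltnW iM).
have i01 j : (j <= M)%N -> 0 <= (j%:R / M%:R : R) <= 1.
  move=> jM; rewrite divr_ge0//= ?ler0n//.
  by rewrite ler_pdivrMr// mul1r ler_nat.
have dist : `|i.+1%:R / M%:R - i%:R / M%:R| <= M%:R^-1 :> R.
  by rewrite -mulrBl -natrB// subSnn mul1r ger0_norm// invr_ge0 ltW.
have dist' : `|i%:R / M%:R - i.+1%:R / M%:R| <= M%:R^-1 :> R by rewrite distrC.
have iv0 : 0 < M%:R^-1 :> R by rewrite invr_gt0.
have up (k : nat) (b : 'I_k -> P) : (k <= N.+1)%N ->
    (forall j, opker D (At (i.+1%:R / M%:R)) (b j)) -> indep b -> (k <= N)%N.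
  move=> kN bW ib.
  apply: (gap_card (lin_subspace_opker (bAt _)) bW ib IH th0 (th k kN)).
  exact: opker_gap iv0 dist' a0 aP (i01 _ (ltnW iM)).
have [[n nN dn]|[b bW ib]] := dim_eq_or_indep (opker D (At (i.+1%:R / M%:R))) N.+1; last first.
  by have := up _ b (leqnn _) bW ib; rewrite ltnn.
suff -> : N = n by [].
apply/eqP; rewrite eqn_leq -[(n <= N)%N]ltnS nN andbT.
have [b [bW [ib _]]] := IH.
apply: (gap_card (lin_subspace_opker (bAt _)) bW ib dn th0 (th N (leqnSn N))).
exact: opker_gap iv0 dist a0 aP (i01 _ iM).
Qed.

End homotopy.

(** Since [A] is onto, every coefficient vector extends to a kernel element of the augmented
    operator, and those with zero coefficients form the kernel of [A]. *)
Lemma dim_opker_aug (R : realType) (P X : normedModType R) k n (D : set X)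
    (A : P -> X -> R) (g : 'I_k -> X -> R) (C : R) :
  op_bounded_lin setT D A -> (forall j, bounded_lin D (g j)) -> open_onto D A C ->
  dim_eq (opker D A) n -> dim_eq (opker D (aug A g)) (n + k).
Proof.
move=> bA bg onA [b [bK [ib bspan]]].
apply: (@dim_ext _ _ _ _ _ (fun p => p.2)) => //.
- by apply: lin_subspace_opker; exact: op_bounded_lin_aug.
- move=> z; have /bounded_linP[c c0 fb] := bounded_lin_sum (fun j => - z 0 j) bg.
  have [p [_ pE]] := onA _ c c0 fb.
  exists (p, z) => // x Dx; rewrite /aug/= -pE// -big_split big1// => j _ /=.
  by rewrite mulNr addNr.
have augE p x : aug A g (p, 0) x = A p x.
  by rewrite /aug/= big1 ?addr0// => j _; rewrite mxE mul0r.
exists (fun i => (b i, 0)); split; [|split].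
- by move=> i; split => // x Dx; rewrite augE bK.
- by move=> c; rewrite sum_pair0 => -[/ib].
- move=> [h z] [hK /= z0]; rewrite z0 in hK *.
  have [|c ->] := bspan h; last by exists c; rewrite sum_pair0.
  by move=> x Dx; rewrite -augE; exact: hK.
Qed.

(** The net functionals are present along the whole homotopy; at t = 0 they only add k to the kernel
    dimension, and this number is carried to t = 1. *)
Lemma compact_perturbation (R : realType) (P X : normedModType R) (D : set X)
    (A K : P -> X -> R) (C : R) n :
  geom_complete P -> op_bounded_lin setT D A -> op_bounded_lin setT D K ->
  0 < C -> open_onto D A C -> dim_eq (opker D A) n ->
  (forall e, 0 < e -> exists k (g : 'I_k -> X -> R), (forall j, bounded_lin D (g j)) /\
     forall p, `|p| <= 1 -> exists i, forall x, D x -> `|K p x - g i x| <= e * `|x|) ->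
  exists k (g : 'I_k -> X -> R), let A' := aug (fun p x => A p x + K p x) g in
    [/\ forall j, bounded_lin D (g j), open_onto D A' (2 * C) &
        dim_eq (opker D A') (n + k)].
Proof.
move=> cP bA bK C0 onA dA net.
have [|k [g [bg gP]]] := net (2 * C)^-1; first by rewrite invr_gt0 mulr_gt0.
have ont t := open_onto_aug cP bA bK bg C0 onA gP (t := t).
pose K' (p : P * 'rV[R]_k) := K p.1.
have bK' : op_bounded_lin setT D K' by exact: op_bounded_lin_fst.
have tE t : aug (fun p x => A p x + t * K p x) g = (fun p x => aug A g p x + t * K' p x).
  by apply/funext => p; apply/funext => x; rewrite /aug /K' addrAC.
have E1 : (fun p x => A p x + K p x) = (fun p x => A p x + 1 * K p x).
  by apply/funext => p; apply/funext => x; rewrite mul1r.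
exists k, g; rewrite /= E1; split => //; first by apply: ont; rewrite ler01 lexx.
rewrite tE; apply: (@opker_dim_homotopy _ _ _ _ _ _ (2 * C)) => //.
- by rewrite mulr_gt0.
- exact: op_bounded_lin_aug.
- by move=> t t01; rewrite -tE; exact: ont.
have -> : (fun p x => aug A g p x + 0 * K' p x) = aug A g.
  by apply/funext => p; apply/funext => x; rewrite mul0r addr0.
exact: dim_opker_aug onA dA.
Qed.

(** * Restriction to subspaces of finite codimension *)

(** Representatives of the cokernel are adjoined: they fill up the range, and being independent
    modulo it they leave the kernel unchanged. *)
Lemma fredholm0_aug (R : realType) (P X : normedModType R) (D : set X) (T : P -> X -> R) :
  geom_complete P -> lin_subspace D -> fredholm0 setT D T ->
  exists n (g : 'I_n -> X -> R) C, [/\ forall j, bounded_lin D (g j), 0 < C,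
    open_onto D (aug T g) C & dim_eq (opker D (aug T g)) n].
Proof.
move=> cP sD [bT [_ [n [[b [bK [ib bspan]]] [g [bg [gspan gind]]]]]]].
have bA := op_bounded_lin_aug bT bg.
have [|C C0 onC] := open_mapping (geom_complete_prod cP (@geom_complete_rV R n)) sD bA.
  move=> f /gspan[h [c [_ fE]]]; exists (h, \row_j c j) => x Dx; rewrite fE//.
  by congr (_ + _); apply: eq_bigr => j _; rewrite mxE.
exists n, g, C; split=> //.
exists (fun i => (b i, 0)); split; [|split].
- move=> i x Dx; rewrite /aug/= (bK i).2// add0r big1// => j _.
  by rewrite mxE mul0r.
- by move=> c; rewrite sum_pair0 => -[/ib].
- move=> [h z] hK.
  have z0 : z = 0.
    by apply/rowP => j; rewrite mxE; apply: (gind h (fun j => z 0 j)) => // x Dx; exact: hK.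
  rewrite z0 in hK *.
  have [|c ->] := bspan h; last by exists c; rewrite sum_pair0.
  split=> // x Dx; rewrite -[LHS]addr0 -[RHS](hK x Dx) /aug/=; congr (_ + _).
  by rewrite big1// => j _; rewrite mxE mul0r.
Qed.

(** Functionals on [D] extend along the projection x - e (l x), so ontoness survives. A functional
    vanishing on [D] is determined by its m values on the e (delta_j), and these are arbitrary, so
    the kernel grows by exactly m. *)
Lemma open_onto_restrict (R : realType) (P X : normedModType R) (D : set X) (A : P -> X -> R)
    (C cl ce : R) n m (l : X -> 'rV[R]_m) (e : 'rV[R]_m -> X) :
  op_bounded_lin setT setT A -> 0 < C -> open_onto setT A C ->
  (forall a x y, l (a *: x + y) = a *: l x + l y) ->
  (forall a x y, e (a *: x + y) = a *: e x + e y) ->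
  0 <= cl -> 0 <= ce -> (forall x, `|l x| <= cl * `|x|) -> (forall z, `|e z| <= ce * `|z|) ->
  (forall z, l (e z) = z) -> (forall x, D x <-> l x = 0) ->
  dim_eq (opker setT A) n ->
  (exists2 C', 0 < C' & open_onto D A C') /\ dim_eq (opker D A) (n + m).
Proof.
move=> bA C0 onA ll el cl0 ce0 lb eb le DP dA.
pose pr x := x - e (l x).
have prl a x y : pr (a *: x + y) = a *: pr x + pr y.
  by rewrite /pr ll el scalerBr opprD addrACA.
have Dpr x : D (pr x).
  by apply/DP; rewrite /pr addrC -scaleN1r ll le scaleN1r addNr.
have prD x : D x -> pr x = x.
  by move=> /DP lx; rewrite /pr lx (lin_fun0 el) subr0.
have prb x : `|pr x| <= (1 + ce * cl) * `|x|.
  rewrite (le_trans (ler_normB _ _))// mulrDl mul1r lerD2l (le_trans (eb _))//.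
  by rewrite -mulrA ler_wpM2l.
have k0 : 0 < 1 + ce * cl by rewrite ltr_pwDl// mulr_ge0.
have bAD : op_bounded_lin setT D A by exact: op_bounded_lin_sub bA.
split.
  exists (C * (1 + ce * cl)); first by rewrite mulr_gt0.
  move=> f c c0 [fl fb].
  have [||p [pC pE]] := onA (f \o pr) ((1 + ce * cl) * c).
  - by rewrite mulr_gt0.
  - split=> [a x y _ _|x _] /=; first by rewrite prl fl.
    by rewrite (le_trans (fb _ (Dpr x)))// -mulrA mulrCA ler_wpM2l ?(ltW c0).
  exists p; split; first by rewrite -mulrA.
  by move=> x Dx; rewrite -pE//= prD.
pose L (p : P) := \row_j A p (e (delta_mx 0 j)) : 'rV[R]_m.
have eE z : e z = \sum_j z 0 j *: e (delta_mx 0 j).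
  by rewrite {1}[z]row_sum_delta lin_fun_sum.
have AeE p z : A p (e z) = \sum_j z 0 j * L p 0 j.
  have [Al _] := bA.2.1 p I.
  rewrite eE (@lin_fun_sum _ _ R^o (A p)); last by move=> *; exact: Al.
  by apply: eq_bigr => j _; rewrite mxE.
apply: (@dim_ext _ _ _ _ _ L); first exact: lin_subspace_opker.
- by move=> a p q; apply/rowP => j; rewrite !mxE (oblP bA).
- move=> z.
  (* The pairing of l x with z vanishes on [D] and equals z_j at e (delta_j). The summand 1 keeps
     the bound positive. *)
  have [||p [_ pE]] := onA (fun x => \sum_j l x 0 j * z 0 j) (1 + cl * (\sum_j `|z 0 j|)).
  + by rewrite ltr_pwDl// mulr_ge0// sumr_ge0.
  + split=> [a x y _ _|x _].
      rewrite scaler_sumr -big_split; apply: eq_bigr => j _.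
      by rewrite ll !mxE /GRing.scale/=; ring.
    rewrite mulrDl mul1r ler_wpDl// mulrAC mulr_sumr (le_trans (ler_norm_sum _ _ _))//.
    apply: ler_sum => j _; rewrite normrM ler_wpM2r//.
    exact: le_trans (rV_norm_ge _ _) (lb x).
  exists p.
    move=> x /DP lx; rewrite -pE// lx big1// => j _.
    by rewrite mxE mul0r.
  apply/rowP => j; rewrite mxE -pE// le (bigD1 j)//= big1 => [|i ij].
    by rewrite mxE !eqxx mul1r addr0.
  by rewrite mxE (negbTE ij) andbF mul0r.
- have -> // : [set p | opker D A p /\ L p = 0] = opker setT A.
  apply/seteqP; split=> p /=.
    move=> [pD Lp] x _; have := pD (pr x) (Dpr x).
    have [Al _] := bA.2.1 p I.
    rewrite /pr addrC -scaleN1r Al// AeE big1; last by move=> j _; rewrite Lp mxE mulr0.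
    by rewrite scaler0 add0r.
  move=> pK; split; first by move=> x _; exact: pK.
  by apply/rowP => j; rewrite !mxE pK.
Qed.

(** The new domain is the kernel of [L], whose number of components [M] equals the dimension of the
    kernel of [A]. The square matrix [Del] of [L] on that kernel decides everything: the new kernel
    is its left kernel, and the new cokernel is a complement of its row space. *)
Lemma fredholm0_restrict (R : realType) (P Q X : normedModType R) (S : set Q) (D : set X)
    (A : P -> X -> R) (j : Q -> P) M (L : P -> 'rV[R]_M) (C cL : R) :
  op_bounded_lin setT D A -> 0 < C -> open_onto D A C -> dim_eq (opker D A) M ->
  (forall a p q, L (a *: p + q) = a *: L p + L q) -> 0 <= cL -> (forall p, `|L p| <= cL * `|p|) ->
  (forall d, exists p, L p = d) ->
  (forall a u v, j (a *: u + v) = a *: j u + j v) -> injective j ->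
  (forall h, S h -> L (j h) = 0) -> (forall p, L p = 0 -> exists2 h, S h & j h = p) ->
  op_bounded_lin S D (fun h => A (j h)) ->
  fredholm0 S D (fun h => A (j h)).
Proof.
move=> bA C0 onA [w [wW [iw wspan]]] Ll cL0 Lb Lonto jl jinj LS SL bT.
have onto f : bounded_lin D f -> exists p, forall x, D x -> f x = A p x.
  by move=> /bounded_linP[c c0 /(onA _ _ c0)[p [_ pE]]]; exists p.
pose Del := \matrix_(i < M) L (w i).
have Lw (c : 'rV[R]_M) : L (\sum_i c 0 i *: w i) = c *m Del.
  rewrite lin_fun_sum// mulmx_sum_row; apply: eq_bigr => i _.
  by rewrite rowK.
have sW := lin_subspace_opker bA.
have LW p : opker D A p -> exists2 c : 'rV[R]_M, p = \sum_i c 0 i *: w i & L p = c *m Del.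
  move=> /wspan[c pE]; have {}pE : p = \sum_i (\row_i c i) 0 i *: w i.
    by rewrite pE; apply: eq_bigr => i _; rewrite mxE.
  by exists (\row_i c i) => //; rewrite -Lw -pE.
have LB p q : L (p - q) = L p - L q by rewrite addrC -scaleN1r Ll scaleN1r addrC.
split=> //; split.
  move=> f fb close; have [p pE] := onto f fb.
  suff /submxP[c cE] : (L p <= Del)%MS.
    have [|h Sh hE] := SL (p - \sum_i c 0 i *: w i); first by rewrite LB Lw cE subrr.
    exists h; split => // x Dx.
    by rewrite hE (oblB bA)// (lin_subspace_sum _ sW wW)// subr0 pE.
  (* The functional A p lies in the range when L p lies in the row space of [Del]. Approximating it
     up to 2^-k puts L p within O(2^-k) of that space, so its product with [cokermx Del]
     vanishes. *)
  rewrite submxE; apply/eqP/rowP => i; rewrite [RHS]mxE.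
  have q01 : 0 < (2^-1 : R) < 1 by apply/andP; split; lra.
  apply: (@geom_small _ _ (C * cL * \sum_k `|cokermx Del k i|) _ q01) => k.
  have e0 : 0 < (2^-1 : R) ^+ k by rewrite exprn_gt0//; case/andP: q01.
  have [h [Sh hE]] := close _ e0.
  have [|q [qC qE]] := onA (A (p - j h)) (2^-1 ^+ k) e0.
    split=> [a x y Dx Dy|x Dx]; first by rewrite (bA.2.1 _ I).1.
    by rewrite (oblB bA)// -pE// hE.
  have /LW[c _] : opker D A (p - j h - q).
    by move=> x Dx; rewrite (oblB bA)// qE// subrr.
  rewrite !LB LS// subr0 => /eqP; rewrite subr_eq => /eqP ->.
  rewrite mulmxDl -mulmxA mulmx_coker mulmx0 add0r mxE (le_trans (ler_norm_sum _ _ _))//.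
  have Lq : `|L q| <= C * cL * 2^-1 ^+ k.
    by rewrite (le_trans (Lb q))// -mulrA mulrCA ler_wpM2l.
  rewrite mulrAC mulr_sumr; apply: ler_sum => s _; rewrite normrM ler_wpM2r//.
  exact: le_trans (rV_norm_ge _ _) Lq.
pose r := \rank (kermx Del); exists r.
have sumM n (c : 'I_n -> R) (u : 'M[R]_(n, M)) (q : 'I_M -> P) :
    \sum_i c i *: \sum_s u i s *: q s = \sum_s ((\row_i c i) *m u) 0 s *: q s.
  under eq_bigr do rewrite scaler_sumr.
  rewrite exchange_big; apply: eq_bigr => s _; rewrite mxE scaler_suml.
  by apply: eq_bigr => i _; rewrite mxE scalerA.
split.
  pose u := row_base (kermx Del) : 'M[R]_(r, M).
  have fu : row_free u by exact: row_base_free.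
  have uE : (u :=: kermx Del)%MS by exact: eq_row_base.
  have /choice[h hP] : forall i, exists h, S h /\ j h = \sum_s u i s *: w s.
    move=> i; have [|h Sh hE] := SL (\sum_s u i s *: w s); last by exists h.
    have -> : \sum_s u i s *: w s = \sum_s row i u 0 s *: w s.
      by apply: eq_bigr => s _; rewrite [row i u 0 s]mxE.
    by rewrite Lw; apply/sub_kermxP; rewrite -uE; exact: row_sub.
  exists h; split; [|split].
  - move=> i; split; first exact: (hP i).1.
    by move=> x Dx; rewrite (hP i).2; exact: (lin_subspace_sum _ sW wW).
  - move=> c c0.
    have : \sum_i c i *: j (h i) = 0 by rewrite -lin_fun_sum// c0 lin_fun0.
    under eq_bigr do rewrite (hP _).2.
    rewrite sumM => /iw cu0.
    have : (\row_i c i) *m u = 0 by apply/rowP => s; rewrite cu0 mxE.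
    move=> /eqP; rewrite mulmx_free_eq0// => /eqP/rowP c0' i.
    by have := c0' i; rewrite !mxE.
  - move=> h' [Sh' hK]; have [a jh La] := LW (j h') hK.
    have : (a <= u)%MS by rewrite uE; apply/sub_kermxP; rewrite -La LS.
    move=> /submxP[c cE]; exists (fun i => c 0 i); apply: jinj.
    rewrite lin_fun_sum//; under eq_bigr do rewrite (hP _).2.
    rewrite sumM jh cE; apply: eq_bigr => s _; congr ((_ *m _) 0 s *: _).
    by apply/rowP => i; rewrite mxE.
(* Preimages under [L] of a basis of a complement of the row space, mapped by [A], represent the
   cokernel. *)
have [v fv vE] : exists2 v : 'M[R]_(r, M), row_free v & (v :=: Del^C)%MS.
  rewrite /r mxrank_ker -mxrank_compl; exists (row_base Del^C%MS); first exact: row_base_free.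
  exact: eq_row_base.
have /choice[q qP] : forall i, exists q, L q = row i v by move=> i; exact: Lonto.
have Lq (c : 'I_r -> R) : L (\sum_i c i *: q i) = (\row_i c i) *m v.
  rewrite lin_fun_sum// mulmx_sum_row; apply: eq_bigr => i _.
  by rewrite mxE qP.
have Aq (c : 'I_r -> R) x : D x -> A (\sum_i c i *: q i) x = \sum_i c i * A (q i) x.
  by move=> Dx; rewrite (obl_sum bA)//; apply: eq_bigr => i _; rewrite (oblZ bA).
exists (fun i => A (q i)); split; [|split].
- by move=> i; exact: bA.2.1.
- move=> f /onto[p pE].
  have : (L p <= Del + v)%MS.
    apply: submx_trans (submx1 _) _; rewrite (adds_eqmx (eqmx_refl _) vE).
    by rewrite sub1mx addsmx_compl_full.
  move=> /sub_addsmxP[[a b] /= LpE].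
  have [|h Sh hE] := SL (p - \sum_i a 0 i *: w i - \sum_i b 0 i *: q i).
    rewrite !LB Lw Lq LpE; have -> : \row_i b 0 i = b by apply/rowP => i; rewrite mxE.
    by rewrite addrAC addrK subrr.
  exists h, (fun i => b 0 i); split => // x Dx.
  by rewrite hE !(oblB bA)// (lin_subspace_sum _ sW wW)// subr0 Aq// subrK pE.
- move=> h c Sh hc0.
  have /LW[a _] : opker D A (j h + \sum_i c i *: q i).
    by move=> x Dx; rewrite (oblD bA)// Aq// hc0.
  rewrite -[j h]scale1r Ll LS// scaler0 add0r Lq => cv.
  have : ((\row_i c i) *m v <= Del :&: Del^C)%MS.
    rewrite sub_capmx {1}cv submxMl/= -vE submxMl//.
  rewrite capmx_compl submx0 mulmx_free_eq0// => /eqP/rowP c0' i.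
  by have := c0' i; rewrite !mxE.
Qed.

Lemma bounded_lin_pos (R : realType) (X Z : normedModType R) (D : set X) (f : X -> Z) :
  bounded_lin D f -> exists2 c, 0 < c & forall x, D x -> `|f x| <= c * `|x|.
Proof.
move=> [_ [c fc]]; exists (`|c| + 1) => [|x Dx]; first by rewrite ltr_wpDl.
by rewrite (le_trans (fc x Dx))// ler_wpM2r// (le_trans (ler_norm _))// lerDl.
Qed.

Lemma fredholm0_constrained (R : realType) (V Y : completeNormedModType R) m
    (iota : V -> Y) (T K : V -> Y -> R) (l : Y -> 'rV[R]_m) (e : 'rV[R]_m -> V) (D : set Y) :
  bounded_lin setT iota -> bounded_lin setT l -> bounded_lin setT e ->
  (forall z, l (iota (e z)) = z) -> (forall x, D x <-> l x = 0) ->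
  fredholm0 setT setT T -> op_bounded_lin setT setT K ->
  (forall eps, 0 < eps -> exists k (g : 'I_k -> Y -> R), (forall j, bounded_lin setT (g j)) /\
     forall v, `|v| <= 1 -> exists i, forall x, `|K v x - g i x| <= eps * `|x|) ->
  fredholm0 [set v | l (iota v) = 0] D (fun v x => T v x + K v x).
Proof.
move=> bi bl be lie DP fT bK net.
have [ci ci0 ciP] := bounded_lin_pos bi.
have [cl cl0 clP] := bounded_lin_pos bl.
have [ce ce0 ceP] := bounded_lin_pos be.
have il a u v : iota (a *: u + v) = a *: iota u + iota v by exact: bi.1.
have ll a u v : l (a *: u + v) = a *: l u + l v by exact: bl.1.
have el a u v : e (a *: u + v) = a *: e u + e v by exact: be.1.
have [n [g [C [bg C0 onA dA]]]] :=
  fredholm0_aug (@complete_geom R V) (conj I (fun a x y _ _ => I)) fT.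
have bT := fT.1.
pose K1 (p : V * 'rV[R]_n) := K p.1.
have bK1 : op_bounded_lin setT setT K1 by exact: op_bounded_lin_fst.
have cP : geom_complete (V * 'rV[R]_n)%type.
  by apply: geom_complete_prod; [exact: complete_geom|exact: geom_complete_rV].
have [|k [g2 [bg2 onA2 dA2]]] := compact_perturbation cP (op_bounded_lin_aug bT bg) bK1 C0 onA dA.
  move=> eps /net[k [f [bf fP]]]; exists k, f; split => // p p1.
  have [|i iP] := fP p.1; first by rewrite (le_trans _ p1)// prod_normE le_max lexx.
  by exists i => x _; exact: iP.
set A2 := aug _ _ in onA2 dA2.
have b12 : op_bounded_lin setT setT (fun p x => aug T g p x + K1 p x).
  have := op_bounded_linD 1 (op_bounded_lin_aug bT bg) bK1.
  by under eq_fun do under eq_fun do rewrite mul1r.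
have bA2 : op_bounded_lin setT setT A2 by exact: op_bounded_lin_aug.
have [||||||[C' C'0 onD] dD] := open_onto_restrict (cl := cl) (ce := ci * ce)
    (e := iota \o e) (l := l) (D := D) bA2 _ onA2 ll _ _ _ _ _ lie DP dA2.
- by rewrite mulr_gt0.
- by move=> a u v /=; rewrite el il.
- exact: ltW.
- by rewrite mulr_ge0// ltW.
- by move=> x; exact: clP.
- move=> z /=; rewrite (le_trans (ciP _ I))// -mulrA ler_wpM2l ?(ltW ci0)//.
  exact: ceP.
have bA2D : op_bounded_lin setT D A2 by exact: op_bounded_lin_sub bA2.
pose j (h : V) : (V * 'rV[R]_n) * 'rV[R]_k := ((h, 0), 0).
have A2j h : A2 (j h) = (fun x => T h x + K h x).
  apply/funext => x; rewrite /A2 /aug/= /K1/=.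
  rewrite [X in _ + X]big1 ?addr0; last by move=> i _; rewrite mxE mul0r.
  by rewrite big1 ?addr0// => i _; rewrite mxE mul0r.
(* The n + k auxiliary coefficients and the m components of the constraint: as many as the dimension
   of the kernel of [A2] tested on [D]. *)
pose L (p : (V * 'rV[R]_n) * 'rV[R]_k) : 'rV[R]_(n + k + m) :=
  row_mx (row_mx p.1.2 p.2) (l (iota p.1.1)).
have -> : (fun v x => T v x + K v x) = (fun h => A2 (j h)).
  by apply/funext => h; rewrite A2j.
have Ll a p q : L (a *: p + q) = a *: L p + L q.
  by rewrite /L/= il ll !scale_row_mx !add_row_mx.
have jl a u v : j (a *: u + v) = a *: j u + j v.
  by rewrite /j; congr (_, _, _); rewrite /= scaler0 addr0.
apply: (fredholm0_restrict (cL := 1 + cl * ci) (L := L) bA2D C'0 onD dD) => //.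
- by rewrite addr_ge0// mulr_ge0// ltW.
- move=> p; have n11 : `|p.1.1| <= `|p| by rewrite !prod_normE !le_max lexx.
  have n12 : `|p.1.2| <= `|p| by rewrite !prod_normE !le_max lexx orbT.
  have n2 : `|p.2| <= `|p| by rewrite [leRHS]prod_normE !le_max lexx orbT.
  have c0 : 0 <= cl * ci by rewrite mulr_ge0 ?ltW.
  apply: rV_norm_le => [|i]; first by rewrite mulr_ge0// addr_ge0.
  rewrite mulrDl mul1r mxE; case: fintype.split => a.
    apply: (@le_trans _ _ `|p|); last by rewrite lerDl mulr_ge0.
    rewrite mxE; case: fintype.split => b.
      exact: le_trans (rV_norm_ge _ _) n12.
    exact: le_trans (rV_norm_ge _ _) n2.
  rewrite ler_wpDl// (le_trans (rV_norm_ge _ _))// (le_trans (clP _ I))//.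
  rewrite -mulrA ler_wpM2l ?(ltW cl0)// (le_trans (ciP _ I))//.
  by rewrite ler_wpM2l ?(ltW ci0).
- move=> d; exists ((e (rsubmx d), lsubmx (lsubmx d)), rsubmx (lsubmx d)).
  by rewrite /L/= lie !hsubmxK.
- by move=> u v [].
- by move=> h /= hS; rewrite /L/= hS !row_mx0.
- move=> [[h a] b]; rewrite /L/= => /eqP; rewrite !row_mx_eq0 => /andP[/andP[/eqP-> /eqP->] /eqP lh].
  by exists h.
- have [h1 [h2 [c h3]]] := bA2D; split; [|split].
  + by move=> a u v x _ _ Dx; rewrite jl h1.
  + by move=> h _; exact: h2.
  + exists c => h x _ Dx; rewrite (le_trans (h3 _ _ I Dx))//.
    rewrite ler_wpM2r//; have -> // : `|j h| = `|h|.
    by rewrite !prod_normE/= !normr0 !(max_idPl _).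
Qed.

(** * Closures, Lipschitz estimates and the inverse on the complement *)

Lemma closure_normP (R : realType) (X : normedModType R) (A : set X) (x : X) :
  closure A x <-> forall e : R, 0 < e -> exists2 y, A y & `|x - y| < e.
Proof.
split=> [clA e e0|dist B /nbhs_ballP[e/= e0 eB]].
  have [y [Ay]] := clA _ (nbhsx_ballx x e e0).
  by rewrite -ball_normE/= => ?; exists y.
have [y Ay xy] := dist e e0; exists y; split=> //; apply: eB.
by rewrite -ball_normE.
Qed.

Lemma cvg_dist_le (R : realType) (X : normedModType R) (u v : nat -> X) (a b : X) (B : R) :
  u @ \oo --> a -> v @ \oo --> b -> (forall n, `|u n - v n| <= B) -> `|a - b| <= B.
Proof.
move=> /cvgrPdist_lt ua /cvgrPdist_lt vb uvB; apply/ler_addgt0Pr => e e0.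
have e2 : 0 < e / 2 by rewrite divr_gt0.
have [N1 _ h1] := ua _ e2; have [N2 _ h2] := vb _ e2.
have /= d1 := h1 _ (leq_maxl N1 N2); have /= d2 := h2 _ (leq_maxr N1 N2).
move: d1 d2 (uvB (maxn N1 N2)); set n := maxn N1 N2 => d1 d2 d3.
have := ler_distD (u n) a b; have := ler_distD (v n) (u n) b.
by rewrite (distrC (v n)); lra.
Qed.

(** The constant terms cancel, and for k >= 1 the k-th term is at most c_k r^k (|h| / r). For psi
    this estimate suffices: the constraint then yields its derivative. *)
Lemma analytic_lipschitz (R : realType) (P Z : normedModType R) (S O : set P) (f : P -> Z) w :
  lin_subspace S -> analytic_on S O f -> O w ->
  exists2 K : R, 0 < K & exists2 d : R, 0 < d & forall h, S h -> `|h| < d ->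
    O (w + h) /\ `|f (w + h) - f w| <= K * `|h|.
Proof.
move=> [S0 _] [_ an] Ow; have [r r0 [A [c [Ac [[M MP] cvA]]]]] := an w Ow.
have M0 : 0 <= M by have := MP 0%N; rewrite big_ord0.
exists ((M + 1) / r); first by rewrite divr_gt0// ltr_wpDl.
exists r => // h Sh hr; have [Oh cvh] := cvA h Sh hr; split=> //.
have [_ cv0] : O (w + 0) /\ (fun N => \sum_(k < N) A k (fun=> 0)) @ \oo --> f (w + 0).
  by apply: cvA; rewrite ?normr0.
rewrite addr0 in cv0.
apply: (cvg_dist_le cvh cv0) => N; rewrite -sumrB.
apply: le_trans (ler_norm_sum _ _ _) _.
have hr1 : `|h| / r <= 1 by rewrite ler_pdivrMr// mul1r ltW.
have hr0 : 0 <= `|h| / r by rewrite divr_ge0// ltW.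
apply: (@le_trans _ _ (\sum_(k < N) c k * r ^+ k * (`|h| / r))); last first.
  rewrite -mulr_suml (le_trans (ler_wpM2r hr0 (MP N)))//.
  by rewrite -mulrA [r^-1 * _]mulrC ler_wpM2r// lerDl.
apply: ler_sum => -[[|k] kN] _ /=.
  have -> : (fun=> h) = (fun=> 0) :> ('I_0 -> P) by apply/funext => -[].
  rewrite subrr normr0 mulr_ge0// mulr_ge0 ?exprn_ge0 ?(ltW r0)//.
  exact: (Ac 0%N).1.
have [c0 [_ Ab]] := Ac k.+1.
have -> : A k.+1 (fun=> 0) = 0.
  apply/eqP; rewrite -normr_le0 (le_trans (Ab (fun=> 0) _))//.
  by rewrite big_ord_recl normr0 mul0r mulr0.
rewrite subr0 (le_trans (Ab (fun=> h) _))// -mulrA ler_wpM2l//.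
rewrite prodr_const card_ord -{1}[`|h|](divfK (lt0r_neq0 r0)) exprMn mulrC ler_wpM2l//.
  by rewrite exprn_ge0// ltW.
by rewrite exprS ler_piMr// exprn_ile1.
Qed.

(** Linearity comes from uniqueness, boundedness from the finite dimension of the source. *)
Lemma complement_inverse (R : realType) (V : normedModType R) m (V1 : set V)
    (f : V -> 'rV[R]_m) :
  lin_subspace V1 -> (forall a u v, f (a *: u + v) = a *: f u + f v) ->
  (forall z, exists! v, V1 v /\ f v = z) ->
  exists B : 'rV[R]_m -> V, [/\ bounded_lin setT B, forall z, V1 (B z),
    forall z, f (B z) = z & forall v, V1 v -> B (f v) = v].
Proof.
move=> [V10 V1D] fl uniq.
have /choice[B BP] : forall z, exists v, (V1 v /\ f v = z) /\
    forall v', V1 v' /\ f v' = z -> v = v'.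
  by move=> z; have [v vP] := uniq z; exists v.
have Bl a y z : B (a *: y + z) = a *: B y + B z.
  apply: (BP _).2; split; first by apply: V1D; case: (BP y); case: (BP z) => -[] ? _ _ -[].
  by rewrite fl (BP y).1.2 (BP z).1.2.
exists B; split.
- split=> [*|]; first exact: Bl.
  exists (\sum_j `|B (delta_mx 0 j)|) => z _.
  rewrite {1}[z]row_sum_delta lin_fun_sum// (le_trans (ler_norm_sum _ _ _))//.
  rewrite mulr_suml; apply: ler_sum => j _; rewrite normrZ mulrC ler_wpM2l//.
  exact: rV_norm_ge.
- by move=> z; case: (BP z) => -[].
- by move=> z; case: (BP z) => -[].
- by move=> v V1v; apply: (BP _).2.
Qed.

Lemma op_deriv_lipschitz (R : realType) (P X Z : normedModType R) (D : set X)
    (Phi : P -> X -> Z) p T :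
  is_op_deriv setT D Phi p T -> exists2 c : R, 0 < c & exists2 d : R, 0 < d &
    forall k x, `|k| < d -> D x -> `|Phi (p + k) x - Phi p x| <= c * `|k| * `|x|.
Proof.
move=> [bT der]; have [c c0 cP] := obl_bound bT.
have [d d0 dP] := der 1 ltr01.
exists (1 + c); first by rewrite addr_gt0.
exists d => // k x kd Dx; rewrite -(subrK (T k x) (_ - _)) (le_trans (ler_normD _ _))//.
by rewrite -mulrA mulrDl lerD// mulrA ?cP// dP.
Qed.

(** * The reduced functional *)

Lemma bounded_lin_comp (R : realType) (X Z W : normedModType R) (f : X -> Z) (g : Z -> W) :
  bounded_lin setT f -> bounded_lin setT g -> bounded_lin setT (g \o f).
Proof.
move=> bf bg; have [c c0 cP] := bounded_lin_pos bf; have [d d0 dP] := bounded_lin_pos bg.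
split=> [a x y _ _|]; first by rewrite /= bf.1// bg.1.
exists (d * c) => x _ /=; rewrite (le_trans (dP _ I))// -mulrA ler_wpM2l ?(ltW d0)//.
exact: cP.
Qed.

Lemma op_bounded_lin_comp (R : realType) (P X Z W : normedModType R)
    (T : P -> X -> Z) (g : Z -> W) :
  op_bounded_lin setT setT T -> bounded_lin setT g ->
  op_bounded_lin setT setT (fun p x => g (T p x)).
Proof.
move=> bT bg; have [c c0 cP] := obl_bound bT; have [d d0 dP] := bounded_lin_pos bg.
split; [|split].
- by move=> a u v x _ _ _; rewrite bT.1// bg.1.
- by move=> p _; apply: (bounded_lin_comp _ bg); exact: bT.2.1.
- exists (d * c) => p x _ _; rewrite (le_trans (dP _ I))// -!mulrA ler_wpM2l ?(ltW d0)//.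
  by rewrite mulrA cP.
Qed.

Section bounded_lin_setT.
Variables (R : realType) (X Z : normedModType R) (f : X -> Z).
Hypothesis bf : bounded_lin setT f.

Lemma blD x y : f (x + y) = f x + f y.
Proof. by rewrite -[x]scale1r bf.1// !scale1r. Qed.

Lemma bl0 : f 0 = 0.
Proof. by apply: (@addrI _ (f 0)); rewrite -blD !addr0. Qed.

Lemma blN x : f (- x) = - f x.
Proof. by apply/eqP; rewrite -addr_eq0 -blD addNr bl0. Qed.

Lemma blB x y : f (x - y) = f x - f y.
Proof. by rewrite blD blN. Qed.

End bounded_lin_setT.

Section implicit.
Variables (R : realType) (V : normedModType R) (m : nat).
Variables (V0 V1 Omega : set V) (psi : V -> V) (w : V).
Variables (G : V -> 'rV[R]_m) (f : V -> 'rV[R]_m) (B : 'rV[R]_m -> V).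
Hypothesis sV0 : lin_subspace V0.
Hypothesis sV1 : lin_subspace V1.
Hypothesis anpsi : analytic_on V0 Omega psi.
Hypothesis psiV1 : forall v, Omega v -> V1 (psi v).
Hypothesis Gpsi : forall v, Omega v -> G (v + psi v) = 0.
Hypothesis Ow : Omega w.
Hypothesis dGf : is_fderiv setT G (w + psi w) f.
Hypothesis bB : bounded_lin setT B.
Hypothesis Bf : forall v, V1 v -> B (f v) = v.

(** G vanishes along the graph of psi, so f (h + D) = o(|h|), where D is the increment of psi and
    the Lipschitz bound controls |h + D|. As D lies in [V1], applying [B] turns this into D + B (f
    h) = o(|h|). *)
Lemma implicit_fderiv : exists2 K : R, 0 < K & forall e, 0 < e ->
  exists2 d, 0 < d & forall h, V0 h -> `|h| < d ->
    [/\ Omega (w + h), `|psi (w + h) - psi w| <= K * `|h| &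
        `|psi (w + h) - psi w + B (f h)| <= e * `|h|].
Proof.
have [K K0 [d1 d10 lip]] := analytic_lipschitz sV0 anpsi Ow.
have [bf der] := dGf; have [cB cB0 cBP] := bounded_lin_pos bB.
exists K => // e e0.
have K1 : 0 < 1 + K by rewrite addr_gt0.
have [|d2 d20 der2] := der (e / (cB * (1 + K))); first by rewrite divr_gt0// mulr_gt0.
exists (Num.min d1 (d2 / (1 + K))); first by rewrite lt_min d10 divr_gt0.
move=> h V0h; rewrite lt_min => /andP[hd1]; rewrite ltr_pdivlMr// => hd2.
have [Owh lipw] := lip h V0h hd1; split=> //.
set D := psi (w + h) - psi w in lipw *.
pose k := h + D.
have kh : `|k| <= (1 + K) * `|h|.
  by rewrite (le_trans (ler_normD _ _))// mulrDl mul1r lerD2l.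
have kd2 : `|k| < d2 by rewrite (le_lt_trans kh)// mulrC.
have := der2 k I kd2.
have -> : w + psi w + k = w + h + psi (w + h).
  by rewrite /k /D addrACA subrKC.
rewrite !Gpsi// subrr sub0r normrN => fk.
have -> : D + B (f h) = B (f k).
  rewrite (blD bf) (blD bB) [RHS]addrC [B (f D)]Bf//.
  by rewrite /D [X in V1 X]addrC -scaleN1r; apply: sV1.2; exact: psiV1.
rewrite (le_trans (cBP _ I))// (le_trans (ler_wpM2l (ltW cB0) fk))//.
apply: (@le_trans _ _ (cB * (e / (cB * (1 + K)) * ((1 + K) * `|h|)))).
  apply: ler_wpM2l; first exact: ltW.
  by apply: ler_wpM2l => //; rewrite ltW// divr_gt0// mulr_gt0.
rewrite le_eqVlt; apply/orP; left; apply/eqP; field.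
by rewrite !gt_eqF.
Qed.

Lemma reduced_fderiv (E : V -> R) (LE : V -> R) :
  is_fderiv setT E (w + psi w) LE ->
  is_fderiv V0 (fun v => E (v + psi v)) w (fun h => LE (h - B (f h))).
Proof.
move=> [bLE der]; have [K K0 imp] := implicit_fderiv.
have [bf _] := dGf; have [cE cE0 cEP] := bounded_lin_pos bLE.
have [cB cB0 cBP] := bounded_lin_pos bB; have [cf cf0 cfP] := bounded_lin_pos bf.
split.
  split=> [a x y _ _|].
    rewrite bf.1// bB.1// -bLE.1//; congr (LE _).
    by rewrite opprD addrACA scalerBr.
  exists (cE * (1 + cB * cf)) => x _; rewrite (le_trans (cEP _ I))// -mulrA.
  rewrite ler_wpM2l ?(ltW cE0)// (le_trans (ler_normB _ _))// mulrDl mul1r lerD2l.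
  by rewrite (le_trans (cBP _ I))// -mulrA ler_wpM2l ?(ltW cB0)// cfP.
move=> e e0; have K1 : 0 < 1 + K by rewrite addr_gt0.
have [|d1 d10 dP1] := der (e / 2 / (1 + K)); first by rewrite !divr_gt0.
have [|d2 d20 dP2] := imp (e / 2 / cE); first by rewrite !divr_gt0.
exists (Num.min d2 (d1 / (1 + K))); first by rewrite lt_min d20 divr_gt0.
move=> h V0h; rewrite lt_min => /andP[hd2]; rewrite ltr_pdivlMr// => hd1.
have [Owh lipw derpsi] := dP2 h V0h hd2.
set D := psi (w + h) - psi w in lipw derpsi.
pose k := h + D.
have kh : `|k| <= (1 + K) * `|h|.
  by rewrite (le_trans (ler_normD _ _))// mulrDl mul1r lerD2l.
have kd1 : `|k| < d1 by rewrite (le_lt_trans kh)// mulrC.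
have := dP1 k I kd1.
have -> : w + psi w + k = w + h + psi (w + h).
  by rewrite /k /D addrACA subrKC.
move=> Ek.
have -> : E (w + h + psi (w + h)) - E (w + psi w) - LE (h - B (f h)) =
    (E (w + h + psi (w + h)) - E (w + psi w) - LE k) + LE (D + B (f h)).
  have -> : D + B (f h) = k - (h - B (f h)) by rewrite /k opprB addrCA [h + D - h]addrC addKr addrC.
  by rewrite [LE (k - _)](blB bLE); ring.
rewrite (le_trans (ler_normD _ _))//.
have h1 := le_trans (cEP _ I) (ler_wpM2l (ltW cE0) derpsi).
rewrite (le_trans (lerD Ek h1))//.
have h2 : e / 2 / (1 + K) * `|k| <= e / 2 / (1 + K) * ((1 + K) * `|h|).
  by rewrite ler_wpM2l// ltW// !divr_gt0.
rewrite (le_trans (lerD h2 (lexx _)))//.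
rewrite le_eqVlt; apply/orP; left; apply/eqP; field.
by rewrite !gt_eqF.
Qed.

End implicit.

Section reduced_second_derivative.
Variables (R : realType) (V Y : normedModType R) (m : nat) (iota : V -> Y).
Variables (dE : V -> Y -> R) (dG : V -> Y -> 'rV[R]_m).
Variables (d2E : V -> Y -> R) (d2G : V -> Y -> 'rV[R]_m).
Variables (V0 V1 Omega : set V) (D : set Y) (psi : V -> V) (w : V).
Variable (Bs : V -> 'rV[R]_m -> V).
Let u := w + psi w.
Let B := Bs w.
Let lam z := - dE u (iota (B z)).

Hypothesis biota : bounded_lin setT iota.
Hypothesis sV1 : lin_subspace V1.
Hypothesis Ow : Omega w.
Hypothesis bdE : forall v, Omega v -> bounded_lin setT (dE (v + psi v)).
Hypothesis dE' : is_op_deriv setT setT dE u d2E.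
Hypothesis dG' : is_op_deriv setT setT dG u d2G.
Hypothesis bdG : bounded_lin setT (dG u).
Hypothesis bB : bounded_lin setT B.
Hypothesis BsV1 : forall v z, Omega v -> V1 (Bs v z).
Hypothesis BsK : forall v z, Omega v -> dG (v + psi v) (iota (Bs v z)) = z.
Hypothesis BK : forall v, V1 v -> B (dG u (iota v)) = v.
Hypothesis V0E : forall h, V0 h -> dG u (iota h) = 0.
Hypothesis DE : forall x, D x -> dG u x = 0.
Hypothesis imp : exists2 K : R, 0 < K & forall e, 0 < e ->
  exists2 d, 0 < d & forall h, V0 h -> `|h| < d ->
    [/\ Omega (w + h), `|psi (w + h) - psi w| <= K * `|h| &
        `|psi (w + h) - psi w + B (dG u (iota h))| <= e * `|h|].

Lemma bounded_lin_multiplier : bounded_lin setT lam.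
Proof.
have := bounded_lin_comp bB (bounded_lin_comp biota (bdE Ow)); rewrite -/u => bl.
have [cl cl0 clP] := bounded_lin_pos bl.
split=> [a x y _ _|]; last by exists cl => z _; rewrite normrN; exact: clP.
by rewrite /lam; have /= -> := bl.1 a x y I I; rewrite opprD scalerN.
Qed.

(** On [V0] the derivative of psi at w vanishes, so k = h + o(|h|). On [D] the value z = dG (u + k)
    x is O(|k||x|), so exchanging [Bs (w + h)] for [B] costs O(|k|^2 |x|), and z itself is d2G k x
    up to o(|k||x|). *)
Lemma reduced_op_deriv :
  is_op_deriv V0 D (fun v x => dE (v + psi v) (x - iota (Bs v (dG (v + psi v) x)))) w
    (fun h x => d2E h x + lam (d2G h x)).
Proof.
have bl := bounded_lin_multiplier.
split.
  apply: (@op_bounded_lin_sub _ _ _ _ V0 setT D setT) => //.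
  have := op_bounded_linD 1 dE'.1 (op_bounded_lin_comp dG'.1 bl).
  by under eq_fun do under eq_fun do rewrite mul1r.
have [K K0 imp'] := imp.
have [cl cl0 clP] := bounded_lin_pos bl.
have [ci ci0 ciP] := bounded_lin_pos biota.
have [cB cB0 cBP] := bounded_lin_pos bB.
have [ce ce0 ceP] := bounded_lin_pos (bdE Ow).
have [cE cE0 cEP] := obl_bound dE'.1.
have [cG cG0 cGP] := obl_bound dG'.1.
have [lE lE0 [d1 d10 lEP]] := op_deriv_lipschitz dE'.
have [lG lG0 [d2 d20 lGP]] := op_deriv_lipschitz dG'.
move=> eps eps0.
pose k0 := 1 + K.
pose q := lE * ci + ce * (cB * (lG * ci)) * ci.
pose Q := q * (k0 * (2 * cB * lG * k0)).
pose Ct := k0 + cE + Q + cl * k0 + cl * cG.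
have k00 : 0 < k0 by rewrite addr_gt0.
have q0 : 0 < q by rewrite addr_gt0// !mulr_gt0.
have Q0 : 0 < Q by rewrite !mulr_gt0.
have Ct0 : 0 < Ct by rewrite !addr_gt0// mulr_gt0.
have [e e0 epsE] : exists2 e, 0 < e & eps = Ct * e.
  by exists (eps / Ct); [rewrite divr_gt0|rewrite mulrC divfK ?gt_eqF].
have [d3 d30 E2] := dE'.2 e e0.
have [d4 d40 G2] := dG'.2 e e0.
have [d5 d50 P2] := imp' e e0.
(* Below this radius |b - B z| <= |b| / 2, which is absorbed to bound b by 2 cB |z|. *)
pose d6 := (2 * (cB * (lG * ci)))^-1.
have d60 : 0 < d6 by rewrite invr_gt0 !mulr_gt0.
pose d := Num.min (Num.min (Num.min d1 d2) (Num.min d3 d4)) d6.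
have d0 : 0 < d by rewrite !lt_min d10 d20 d30 d40 d60.
(* The requirement |h| < e turns the quadratic error of the multiplier term into e |h|. *)
exists (Num.min (Num.min d5 e) (d / k0)); first by rewrite !lt_min d50 e0 divr_gt0.
move=> h x V0h; rewrite lt_min => /andP[]; rewrite lt_min => /andP[hd5 he].
rewrite ltr_pdivlMr// => hd Dx.
have [Owh lipw] := P2 h V0h hd5.
rewrite V0E// (bl0 bB) addr0 => derpsi.
set dpsi := psi (w + h) - psi w in lipw derpsi.
pose k := h + dpsi.
have kh : `|k| <= k0 * `|h|.
  by rewrite (le_trans (ler_normD _ _))// mulrDl mul1r lerD2l.
have : `|k| < d by rewrite (le_lt_trans kh)// mulrC.
rewrite !lt_min => /andP[/andP[/andP[kd1 kd2] /andP[kd3 kd4]] kd6].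
have uk : w + h + psi (w + h) = u + k by rewrite /u /k /dpsi addrACA subrKC.
rewrite uk -/u -/B DE// (bl0 bB) (bl0 biota) subr0.
set z := dG (u + k) x; set b := Bs (w + h) z.
have z_le : `|z| <= lG * `|k| * `|x|.
  by have := lGP k x kd2 I; rewrite [dG u x]DE// subr0.
(* Both b and B z lie in [V1], where [B] inverts dG u; moreover dG u (iota (B z)) = z = dG (u + k)
   (iota b). *)
have bE : b - B z = B (dG u (iota b) - dG (u + k) (iota b)).
  rewrite -[LHS]BK; last first.
    by rewrite addrC -scaleN1r; apply: sV1.2; [exact: BsV1|exact: BsV1].
  by rewrite (blB biota) (blB bdG) [dG u (iota (B z))]BsK// -uk [dG (w + h + _) _]BsK.
have ib : `|iota b| <= ci * `|b| by exact: ciP.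
have bB_le : `|b - B z| <= cB * (lG * ci) * `|k| * `|b|.
  rewrite bE (le_trans (cBP _ I))// -!mulrA ler_wpM2l ?(ltW cB0)// distrC.
  rewrite (le_trans (lGP k _ kd2 I))// -mulrA ler_wpM2l ?(ltW lG0)//.
  by rewrite [leRHS]mulrCA ler_wpM2l.
have b_le : `|b| <= 2 * cB * `|z|.
  have small : cB * (lG * ci) * `|k| <= 2^-1.
    have c0 : 0 < cB * (lG * ci) by rewrite !mulr_gt0.
    have : `|k| * (2 * (cB * (lG * ci))) < 1 by rewrite -ltr_pdivlMr ?mul1r// mulr_gt0.
    by lra.
  have h1 : `|b - B z| <= 2^-1 * `|b| by rewrite (le_trans bB_le)// ler_wpM2r.
  have h2 : `|b| <= `|b - B z| + `|B z| by rewrite -{1}[b](subrK (B z)) ler_normD.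
  have h3 : `|B z| <= cB * `|z| by exact: cBP.
  lra.
have bdu : bounded_lin setT (dE u) by exact: bdE.
have bduk : bounded_lin setT (dE (u + k)) by rewrite -uk; exact: bdE.
have mult : `|dE (u + k) (iota b) - dE u (iota (B z))| <= Q * (e * `|h| * `|x|).
  have -> : dE (u + k) (iota b) - dE u (iota (B z)) =
      (dE (u + k) (iota b) - dE u (iota b)) + dE u (iota (b - B z)).
    by rewrite (blB biota) (blB bdu); ring.
  rewrite (le_trans (ler_normD _ _))//.
  have t1 : `|dE (u + k) (iota b) - dE u (iota b)| <= lE * ci * (`|k| * `|b|).
    rewrite (le_trans (lEP k _ kd1 I))// -!mulrA ler_wpM2l ?(ltW lE0)//.
    by rewrite [leRHS]mulrCA ler_wpM2l.
  have t2 : `|dE u (iota (b - B z))| <= ce * (ci * (cB * (lG * ci) * `|k| * `|b|)).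
    rewrite (le_trans (ceP _ I))// ler_wpM2l ?(ltW ce0)// (le_trans (ciP _ I))//.
    by rewrite ler_wpM2l ?(ltW ci0).
  have s1 : `|dE (u + k) (iota b) - dE u (iota b)| + `|dE u (iota (b - B z))| <=
      q * (`|k| * `|b|).
    by apply: le_trans (lerD t1 t2) _; rewrite /q le_eqVlt; apply/orP; left; apply/eqP; ring.
  apply: le_trans s1 _; rewrite /Q -mulrA ler_wpM2l ?(ltW q0)//.
  have b_le' : `|b| <= 2 * cB * lG * k0 * e * `|x|.
    apply: le_trans b_le _; rewrite -!mulrA !ler_wpM2l ?(ltW cB0)//.
    rewrite (le_trans z_le)// -!mulrA ler_wpM2l ?(ltW lG0)// !mulrA ler_wpM2r//.
    by apply: le_trans kh _; apply: ler_wpM2l; exact: ltW.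
  apply: le_trans (ler_pM _ _ kh b_le') _ => //.
  by rewrite le_eqVlt; apply/orP; left; apply/eqP; ring.
have -> : dE (u + k) (x - iota b) - dE u x - (d2E h x + lam (d2G h x)) =
    (dE (u + k) x - dE u x - d2E k x) + d2E (k - h) x
    - (dE (u + k) (iota b) - dE u (iota (B z)))
    + lam (z - d2G k x) + lam (d2G (k - h) x).
  rewrite (blB bduk) (oblB dE'.1)// (oblB dG'.1)// !(blB bl) /lam; ring.
have khE : k - h = dpsi by rewrite /k addrAC subrr add0r.
have T1 : `|dE (u + k) x - dE u x - d2E k x| <= k0 * (e * `|h| * `|x|).
  rewrite (le_trans (E2 k x I kd3 I))// !mulrA ler_wpM2r// [k0 * e]mulrC -mulrA.
  by rewrite ler_wpM2l// ltW.
have T2 : `|d2E (k - h) x| <= cE * (e * `|h| * `|x|).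
  by rewrite khE (le_trans (cEP _ _ I))// -mulrA ler_wpM2l ?(ltW cE0)// ler_wpM2r.
have T4 : `|lam (z - d2G k x)| <= cl * k0 * (e * `|h| * `|x|).
  rewrite (le_trans (clP _ I))// -mulrA ler_wpM2l ?(ltW cl0)//.
  have := G2 k x I kd4 I; rewrite [dG u x]DE// subr0 => /le_trans; apply.
  rewrite !mulrA ler_wpM2r// [k0 * e]mulrC -mulrA.
  by rewrite ler_wpM2l// ltW.
have T5 : `|lam (d2G (k - h) x)| <= cl * cG * (e * `|h| * `|x|).
  rewrite (le_trans (clP _ I))// -mulrA ler_wpM2l ?(ltW cl0)//.
  by rewrite khE (le_trans (cGP _ _ I))// -mulrA ler_wpM2l ?(ltW cG0)// ler_wpM2r.
rewrite (le_trans (ler_normD _ _))// (le_trans (lerD (ler_normD _ _) T5))//.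
rewrite (le_trans (lerD (lerD (ler_normB _ _) T4) (lexx _)))//.
rewrite (le_trans (lerD (lerD (lerD (ler_normD _ _) mult) (lexx _)) (lexx _)))//.
rewrite (le_trans (lerD (lerD (lerD (lerD T1 T2) (lexx _)) (lexx _)) (lexx _)))//.
by rewrite -!mulrDl -/Ct epsE !mulrA.
Qed.

End reduced_second_derivative.

Unset Implicit Arguments.

Theorem theorem4p3 (R : realType) (V Y : completeNormedModType R) (m : nat)
  (iota : V -> Y) (U : set V)
  (E : V -> R) (G : V -> 'rV[R]_m)
  (dE : V -> Y -> R) (dG : V -> Y -> 'rV[R]_m)
  (d2E : V -> Y -> R) (d2G : V -> Y -> 'rV[R]_m) (ubar : V)
  (V1 Omega0 Omega1 : set V) (psi : V -> V) (wbar : V) :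
  open U ->
  analytic_on setT U E ->
  analytic_on setT U G ->
  (* (i) continuous dense embedding *)
  bounded_lin setT iota -> injective iota -> closure (range iota) = setT ->
  (* (ii) E'(u) in Y^*, analytic U -> Y^* *)
  (forall u, U u -> is_fderiv setT E u (fun v => dE u (iota v))) ->
  analytic_op_on setT U setT dE ->
  (* (iii) E''(ubar) : V -> Y^* Fredholm of index zero *)
  is_op_deriv setT setT dE ubar d2E ->
  fredholm0 setT setT d2E ->
  (* (iv) G'(u) extends to L(Y,R^m), analytic U -> L(Y,R^m) *)
  (forall u, U u -> is_fderiv setT G u (fun v => dG u (iota v))) ->
  analytic_op_on setT U setT dG ->
  (* (v) (bar G')'(ubar) compact *)
  is_op_deriv setT setT dG ubar d2G ->
  compact_op d2G ->
  (* (vi) *)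
  U ubar -> G ubar = 0 ->
  (forall z : 'rV[R]_m, exists v, dG ubar (iota v) = z) ->
  (* V0 = ker G'(ubar), V1 closed complement *)
  let V0 := [set v | dG ubar (iota v) = 0] in
  lin_subspace V1 -> closed V1 ->
  (forall v, exists a b, V0 a /\ V1 b /\ v = a + b) ->
  (forall v, V0 v -> V1 v -> v = 0) ->
  open_in V0 Omega0 -> open_in V1 Omega1 ->
  minkowski_sum Omega0 Omega1 ubar -> minkowski_sum Omega0 Omega1 `<=` U ->
  analytic_on V0 Omega0 psi ->
  psi @` Omega0 `<=` Omega1 ->
  [set u | minkowski_sum Omega0 Omega1 u /\ G u = 0] = [set w + psi w | w in Omega0] ->
  (forall u, minkowski_sum Omega0 Omega1 u ->
     forall z : 'rV[R]_m, exists! v, V1 v /\ dG u (iota v) = z) ->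
  Omega0 wbar -> wbar + psi wbar = ubar ->
  let V0bar := closure (iota @` V0) in
  exists dF : V -> Y -> R,
    (* dF w is the continuous extension to V0bar of F'(w), F = E o phi *)
    (forall w, Omega0 w -> bounded_lin V0bar (dF w) /\
       is_fderiv V0 (fun w' => E (w' + psi w')) w (fun h => dF w (iota h))) /\
    (* F''(wbar) : V0 -> V0bar^* exists and is Fredholm of index zero *)
    exists T : V -> Y -> R, is_op_deriv V0 V0bar dF wbar T /\ fredholm0 V0 V0bar T.
Proof.
move=> _ _ _ bi _ dense dEf anopE dE' fred dGf anopG dG' cG Uu _ _ V0 sV1 _ _ _ O0 O1
  _ OU anpsi psiO1 setE iso Ow wE V0bar.
subst ubar; pose ubar := wbar + psi wbar.
have [il _] := bi; have [ci ci0 ciP] := bounded_lin_pos bi.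
have mink v : Omega0 v -> minkowski_sum Omega0 Omega1 (v + psi v).
  by move=> Ov; exists v, (psi v); split=> //; split=> //; apply: psiO1; exists v.
have Upsi v : Omega0 v -> U (v + psi v) by move=> /mink /OU.
have psiV1 v : Omega0 v -> V1 (psi v).
  by move=> Ov; apply: (O1 _ _).1; apply: psiO1; exists v.
have Gpsi v : Omega0 v -> G (v + psi v) = 0.
  move=> Ov; suff : [set u | minkowski_sum Omega0 Omega1 u /\ G u = 0] (v + psi v) by case.
  by rewrite setE; exists v.
have bdE v : Omega0 v -> bounded_lin setT (dE (v + psi v)) by move=> /Upsi /anopE.2.1.
have bdG v : Omega0 v -> bounded_lin setT (dG (v + psi v)) by move=> /Upsi /anopG.2.1.
have bdGi v (Ov : Omega0 v) := bounded_lin_comp bi (bdG v Ov).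
have /choice[Bs BsP] : forall v, exists B : 'rV[R]_m -> V, Omega0 v ->
    [/\ bounded_lin setT B, forall z, V1 (B z), forall z, dG (v + psi v) (iota (B z)) = z &
        forall x, V1 x -> B (dG (v + psi v) (iota x)) = x].
  move=> v; have [Ov|] := pselect (Omega0 v); last by exists (fun=> 0).
  have [|B BP] := @complement_inverse _ _ _ _ (dG (v + psi v) \o iota) sV1 _ (iso _ (mink v Ov)).
    by move=> a x y; exact: (bdGi v Ov).1.
  by exists B.
have sV0 : lin_subspace V0.
  split=> [|a x y]; first exact: bl0 (bdGi _ Ow).
  rewrite /V0/= => V0x V0y; have /= -> := (bdGi _ Ow).1 a x y I I.
  by rewrite V0x V0y scaler0 addr0.
have [bB BV1 BK KB] := BsP _ Ow.
have [cB cB0 cBP] := bounded_lin_pos bB.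
have [cl cl0 clP] := bounded_lin_pos (bdG _ Ow).
(* The Y-closure of V0 is the kernel of the extended G'(ubar): an approximant iota v given by
   density is pushed back into V0 by subtracting B (G'(ubar) v), which enlarges the error by the
   factor [c] at most. *)
have V0barP x : V0bar x <-> dG ubar x = 0.
  split=> [/closure_normP clx|lx].
    apply/eqP; rewrite -normr_le0; apply/ler_addgt0Pr => e e0; rewrite add0r.
    have [|_ [a V0a <-] xa] := clx (e / cl); first by rewrite divr_gt0.
    have -> : dG ubar x = dG ubar (x - iota a) by rewrite (blB (bdG _ Ow)) V0a subr0.
    by rewrite (le_trans (clP _ I))// mulrC -ler_pdivlMr// ltW.
  apply/closure_normP => e e0.
  pose c := 1 + ci * (cB * cl); have c0 : 0 < c by rewrite addr_gt0// !mulr_gt0.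
  have /closure_normP/(_ (e / c)) : closure (range iota) x by rewrite dense.
  rewrite divr_gt0// => /(_ isT)[_ [v _ <-] xv].
  exists (iota (v - Bs wbar (dG ubar (iota v)))).
    exists (v - Bs wbar (dG ubar (iota v))) => //=.
    by rewrite /V0/= (blB bi) (blB (bdG _ Ow)) BK subrr.
  have -> : x - iota (v - Bs wbar (dG ubar (iota v))) =
      (x - iota v) - iota (Bs wbar (dG ubar (x - iota v))).
    rewrite (blB bi) [dG ubar (x - iota v)](blB (bdG _ Ow)) lx sub0r.
    by rewrite (blN bB) (blN bi) opprK opprB addrA addrAC.
  rewrite (le_lt_trans (ler_normB _ _))//.
  apply: (@le_lt_trans _ _ (c * `|x - iota v|)); last by rewrite mulrC -ltr_pdivlMr.
  rewrite mulrDl mul1r lerD2l (le_trans (ciP _ I))// -!mulrA ler_wpM2l ?(ltW ci0)//.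
  by rewrite (le_trans (cBP _ I))// ler_wpM2l ?(ltW cB0)// clP.
(* The derivative of phi at v is h - B_v (G' h); composing E' with it gives a formula that makes
   sense for every x in Y. *)
exists (fun v x => dE (v + psi v) (x - iota (Bs v (dG (v + psi v) x)))); split.
  move=> v Ov; have [bBv _ _ KBv] := BsP _ Ov; split.
    have bc := bounded_lin_comp (bounded_lin_comp (bdG v Ov) bBv) bi.
    have [cc cc0 ccP] := bounded_lin_pos bc; have [ce ce0 ceP] := bounded_lin_pos (bdE v Ov).
    split=> [a x y _ _|].
      have /= -> := bc.1 a x y I I.
      by rewrite -(bdE v Ov).1// scalerBr opprD addrACA.
    exists (ce * (1 + cc)) => x _; rewrite (le_trans (ceP _ I))// -mulrA ler_wpM2l ?(ltW ce0)//.
    by rewrite (le_trans (ler_normB _ _))// mulrDl mul1r lerD2l ccP.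
  have := reduced_fderiv sV0 sV1 anpsi psiV1 Gpsi Ov (dGf _ (Upsi v Ov)) bBv KBv (dEf _ (Upsi v Ov)).
  rewrite (_ : (fun h => dE _ (iota (h - _))) = (fun h => dE (v + psi v)
     (iota h - iota (Bs v (dG (v + psi v) (iota h))))))//.
  by apply/funext => h; rewrite (blB bi).
pose lam z := - dE ubar (iota (Bs wbar z)).
have blam : bounded_lin setT lam := bounded_lin_multiplier bi Ow bdE bB.
exists (fun h x => d2E h x + lam (d2G h x)); split.
  apply: (@reduced_op_deriv _ _ _ m iota dE dG d2E d2G V0 V1 Omega0 V0bar psi wbar Bs) => //.
  - exact: bdG.
  - by move=> v z /BsP[].
  - by move=> v z /BsP[].
  - by move=> x /V0barP.
  - exact: (implicit_fderiv sV0 sV1 anpsi psiV1 Gpsi Ow (dGf _ Uu) bB KB).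
have [cm cm0 cmP] := bounded_lin_pos blam.
have bK := op_bounded_lin_comp dG'.1 blam.
apply: (fredholm0_constrained bi (bdG _ Ow) bB BK V0barP fred bK) => eps eps0.
(* The multiplier has norm at most [cm], so a net of accuracy eps / cm for [d2G] gives one of
   accuracy eps after applying [lam]. *)
have [|k [v vP]] := compact_op_net (e := eps / cm) cG; first by rewrite divr_gt0.
exists k, (fun i x => lam (d2G (v i) x)); split; first by move=> i; exact: bK.2.1.
move=> h h1; have [i iP] := vP h h1; exists i => x.
rewrite -(blB blam) (le_trans (cmP _ I))// mulrC -ler_pdivlMr//.
by rewrite mulrAC iP.
Qed.
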